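(* Let $\mathcal{P}=(\Omega,\Lambda,\star)$ be an ABQR operad over $\mathbf{k}$ with $\dim\Omega=n$. (1) There is a coherent unit action $(\alpha,\beta)$ on $\mathcal{P}$ with $\alpha\neq\beta$ if and only if there is a basis $\{\odot_1,\dots,\odot_n\}$ of $\Omega$ with $\star=\sum_i\odot_i$ such that $\Lambda$ is contained in the subspace $\Lambda'_{n,\mathrm{coh}}$ of $\Omega^{\otimes2}\oplus\Omega^{\otimes2}$ with basis consisting of - $(\star\otimes\odot_2,\ \odot_2\otimes\odot_2)$, - $(\odot_1\otimes\odot_1,\ \odot_1\otimes\star)$, - $(\odot_i\otimes\odot_1,\ \odot_i\otimes\odot_1)$, $2\le i\le n$, - $(\odot_2\otimes\odot_j,\ \odot_2\otimes\odot_j)$, $3\le j\le n$, - $(\odot_1\otimes\odot_i,\ \odot_i\otimes\odot_2)$, $3\le i\le n$, - $(\odot_i\otimes\odot_j,\ 0)$ and $(0,\ \odot_i\otimes\odot_j)$, $3\le i,j\le n$. (2) There is a coherent unit action $(\alpha,\beta)$ on $\mathcal{P}$ with $\alpha=\beta$ if and only if there is a basis $\{\odot_1,\dots,\odot_n\}$ of $\Omega$ with $\star=\sum_i\odot_i$ such that $\Lambda$ is contained in the subspace $\Lambda''_{n,\mathrm{coh}}$ of $\Omega^{\otimes2}\oplus\Omega^{\otimes2}$ with basis consisting of - $(\odot_1\otimes\star,\ \odot_1\otimes\star)+(\star\otimes\odot_1,\ \star\otimes\odot_1)-(\odot_1\otimes\odot_1,\ \odot_1\otimes\odot_1)$, -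 $(\odot_i\otimes\odot_j,\ 0)$ and $(0,\ \odot_i\otimes\odot_j)$, $2\le i,j\le n$. (3) There is a compatible unit action $(\alpha,\beta)$ on $\mathcal{P}$ with $\alpha\neq\beta$ if and only if there is a basis $\{\odot_1,\dots,\odot_n\}$ of $\Omega$ with $\star=\sum_i\odot_i$ such that $\Lambda$ is contained in the subspace $\Lambda'_{n,\mathrm{comp}}$ of $\Omega^{\otimes2}\oplus\Omega^{\otimes2}$ with basis consisting of - $((\odot_1+\odot_2)\otimes\odot_2,\ \odot_2\otimes\odot_2)$, - $(\odot_1\otimes\odot_1,\ \odot_1\otimes(\odot_1+\odot_2))$, - $(\odot_i\otimes\odot_1,\ \odot_i\otimes\odot_1)$, $2\le i\le n$, - $(\odot_2\otimes\odot_j,\ \odot_2\otimes\odot_j)$, $3\le j\le n$, - $(\odot_1\otimes\odot_i,\ \odot_i\otimes\odot_2)$, $3\le i\le n$, - $(\odot_i\otimes\odot_2,\ 0)$ and $(0,\ \odot_1\otimes\odot_i)$, $3\le i\le n$, - $(\odot_i\otimes\odot_j,\ 0)$ and $(0,\ \odot_i\otimes\odot_j)$, $3\le i,j\le n$. (4) There is a compatible unit action $(\alpha,\beta)$ on $\mathcal{P}$ with $\alpha=\beta$ if and only if there is a basis $\{\odot_1,\dots,\odot_n\}$ of $\Omega$ with $\star=\sum_i\odot_i$ such that $\Lambda$ is contained in the subspace $\Lambda''_{n,\mathrm{comp}}$ of $\Omega^{\otimes2}\oplus\Omega^{\otimes2}$ with basis consisting of - $(\odot_1\otimes\odot_1,\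 \odot_1\otimes\odot_1)$, - $(\odot_1\otimes\odot_i,\ \odot_1\otimes\odot_i)+(\odot_i\otimes\odot_1,\ \odot_i\otimes\odot_1)$, $2\le i\le n$, - $(\odot_i\otimes\odot_j,\ 0)$ and $(0,\ \odot_i\otimes\odot_j)$, $2\le i,j\le n$. (In (1) and (3) the condition on the basis refers to $\odot_1$ and $\odot_2$, so it presupposes $n\ge 2$ and is regarded as failing when $n=1$.)
   Context: $\mathbf{k}$ is a field of characteristic zero. A binary quadratic regular operad is given by a pair $(\Omega,\Lambda)$, where $\Omega$ is a finite-dimensional $\mathbf{k}$-vector space (the generators, i.e. binary operations) and $\Lambda$ is a subspace of $\Omega^{\otimes 2}\oplus\Omega^{\otimes 2}$ (the relations). A $\mathcal{P}$-algebra for $\mathcal{P}=(\Omega,\Lambda)$ is a $\mathbf{k}$-vector space $A$ with a bilinear operation $(x,y)\mapsto x\odot y$ for each $\odot\in\Omega$, depending linearly on $\odot$, such that for each $(\sum_i \odot^{(1)}_i\otimes\odot^{(2)}_i,\sum_j\odot^{(3)}_j\otimes\odot^{(4)}_j)\in\Lambda$ one has $$\sum_i (x\odot^{(1)}_i y)\odot^{(2)}_i z=\sum_j x\odot^{(3)}_j(y\odot^{(4)}_j z)\quad\text{for all }x,y,z\in A.$$ An ABQR operad is a triple $(\Omega,\Lambda,\star)$ where $\Omega$ is a finite-dimensional $\mathbf{k}$-vector space, $\Lambda$ is a subspace of $\Omega^{\otimes 2}\oplus\Omega^{\otimes 2}$ (so that $(\Omega,\Lambda)$ is a binary quadratic regular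 operad), and $\star\in\Omega$ is a chosen element with $(\star\otimes\star,\star\otimes\star)\in\Lambda$ (so $\star$ is associative in every algebra). A unit action on $(\Omega,\Lambda,\star)$ is a pair of linear maps $\alpha,\beta:\Omega\to\mathbf{k}$ with $\alpha(\star)=\beta(\star)=1$. For a $\mathcal{P}$-algebra $A$ put $A_+=\mathbf{k}1\oplus A$. Each $\odot\in\Omega$ is extended to a partially defined bilinear operation $\tilde\odot$ on $A_+$: $a\,\tilde\odot\, b=a\odot b$ for $a,b\in A$; $a\,\tilde\odot\,1=\alpha(\odot)a$ for $a\in A$; $1\,\tilde\odot\,b=\beta(\odot)b$ for $b\in A$; $1\,\tilde\star\,1=1$; and $1\,\tilde\odot\,1$ is undefined for $\odot\ne\star$. The unit action is compatible if the relations of $\mathcal{P}$ remain valid on $A_+$ for each $\mathcal{P}$-algebra $A$ whenever the terms are defined: for every $(\sum_i \odot^{(1)}_i\otimes\odot^{(2)}_i,\sum_j\odot^{(3)}_j\otimes\odot^{(4)}_j)\in\Lambda$ one has $\sum_i (x\,\tilde\odot^{(1)}_i y)\,\tilde\odot^{(2)}_i z=\sum_j x\,\tilde\odot^{(3)}_j(y\,\tilde\odot^{(4)}_j z)$ for all $x,y,z\in A_+$ for which both sides make sense. For $\mathcal{P}$-algebras $A,B$ let $A\boxtimes B=(A\otimes\mathbf{k}1)\oplus(\mathbf{k}1\otimes B)\oplus(A\otimes B)\subset A_+\otimes B_+$, and for $\odot\in\Omega$ define a bilinear operation $\boxdot$ on $A\boxtimes B$ by $(a\otimes b)\boxdot(a'\otimes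 b')=(a\,\tilde\star\,a')\otimes(b\,\tilde\odot\,b')$ if $b\otimes b'\neq 1\otimes1$, and $(a\otimes b)\boxdot(a'\otimes b')=(a\,\tilde\odot\,a')\otimes1$ if $b\otimes b'=1\otimes 1$ (here $b,b'$ each are $1$ or in $B$, and likewise $a,a'$ each are $1$ or in $A$). A (compatible) unit action is coherent if, for all $\mathcal{P}$-algebras $A$ and $B$, $A\boxtimes B$ with these operations is again a $\mathcal{P}$-algebra. *)

(* Defs.v *)
From HB Require Import structures.
From mathcomp Require Import all_boot all_order all_algebra.
From mathcomp Require Import boolp.

Set Implicit Arguments.
Unset Strict Implicit.
Unset Printing Implicit Defensive.

Import GRing.Theory.
Local Open Scope ring_scope.

(* The tensor product A ⊗ B of two arbitrary (possibly infinite-dimensional)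
   vector spaces.  A list [:: (a1, b1); ...] stands for the formal sum of the
   a_i ⊗ b_i; scalars are absorbed into the factors, so that the quotient of
   lists by tensor_eq is the usual quotient of the free vector space on A * B
   by the bilinearity relations. *)
Section Tensor.
Variables (k : fieldType) (A B : lmodType k).

Inductive tensor_eq : seq (A * B) -> seq (A * B) -> Prop :=
| TensorPerm s t : perm_eq s t -> tensor_eq s t
| TensorSym s t : tensor_eq s t -> tensor_eq t s
| TensorTrans s t u : tensor_eq s t -> tensor_eq t u -> tensor_eq s u
| TensorCons p s t : tensor_eq s t -> tensor_eq (p :: s) (p :: t)
| TensorZero b : tensor_eq [:: (0, b)] [::]
| TensorAddl a a' b : tensor_eq [:: (a + a', b)] [:: (a, b); (a', b)]
| TensorAddr a b b' : tensor_eq [:: (a, b + b')] [:: (a, b); (a, b')]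
| TensorScale c a b : tensor_eq [:: (c *: a, b)] [:: (a, c *: b)].

Lemma tensor_eq_refl s : tensor_eq s s.
Proof. exact/TensorPerm/perm_refl. Qed.

Lemma tensor_eq_cat s s' t t' :
  tensor_eq s s' -> tensor_eq t t' -> tensor_eq (s ++ t) (s' ++ t').
Proof.
have catl u v w : tensor_eq v w -> tensor_eq (u ++ v) (u ++ w).
  by move=> vw; elim: u => //= p u IHu; apply: TensorCons.
have catC u v : tensor_eq (u ++ v) (v ++ u).
  by apply/TensorPerm; rewrite perm_catC.
move=> ss' tt'; apply: TensorTrans (catl _ _ _ tt') _.
apply: TensorTrans (catC _ _) _; apply: TensorTrans (catC _ _).
exact: catl.
Qed.

Definition tensor_rel : rel (seq (A * B)) := fun s t => `[< tensor_eq s t >].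

Lemma tensor_rel_equiv : equiv_class_of tensor_rel.
Proof.
split=> [s|s t|t s u]; first exact/asboolP/tensor_eq_refl.
- by apply/asboolP/asboolP => /TensorSym.
- by move=> /asboolP st /asboolP tu; apply/asboolP; apply: TensorTrans st tu.
Qed.

Canonical tensor_equiv := EquivRelPack tensor_rel_equiv.
Canonical tensor_enc := defaultEncModRel tensor_rel.

Definition tensor := {eq_quot tensor_rel}%qT.
HB.instance Definition _ := EqQuotient.on tensor.
HB.instance Definition _ := Choice.on tensor.

Local Notation pi s := (\pi_tensor%qT s).

Lemma tensor_piP s t : pi s = pi t <-> tensor_eq s t.
Proof.
split=> [/eqP|st]; first by rewrite eqmodE => /asboolP.
by apply/eqP; rewrite eqmodE; apply/asboolP.
Qed.

Lemma tensor_repr s : tensor_eq (repr (pi s)) s.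
Proof. by apply/tensor_piP; rewrite reprK. Qed.

Definition pure (a : A) (b : B) : tensor := pi [:: (a, b)].

Definition tensor_zero : tensor := pi [::].
Definition tensor_add (x y : tensor) : tensor := pi (repr x ++ repr y).
Definition scale_formal (c : k) (s : seq (A * B)) :=
  [seq (c *: p.1, p.2) | p <- s].
Definition tensor_scale (c : k) (x : tensor) : tensor :=
  pi (scale_formal c (repr x)).
Definition tensor_opp := tensor_scale (- 1).

Lemma pi_cat s t : pi (s ++ t) = tensor_add (pi s) (pi t).
Proof.
by apply/tensor_piP/TensorSym/tensor_eq_cat; apply: tensor_repr.
Qed.

Lemma scale_formal_eq c s t :
  tensor_eq s t -> tensor_eq (scale_formal c s) (scale_formal c t).
Proof.
elim=> {s t}.
- by move=> s t st; apply/TensorPerm/perm_map.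
- by move=> s t _; apply: TensorSym.
- by move=> s t u _ st _; apply: TensorTrans st.
- by move=> p s t _ /=; apply: TensorCons.
- by move=> b /=; rewrite scaler0; apply: TensorZero.
- by move=> a a' b /=; rewrite scalerDr; apply: TensorAddl.
- by move=> a b b'; apply: TensorAddr.
- move=> d a b /=; rewrite scalerA mulrC -scalerA; exact: TensorScale.
Qed.

Lemma pi_scale c s : pi (scale_formal c s) = tensor_scale c (pi s).
Proof. by apply/tensor_piP/scale_formal_eq/TensorSym/tensor_repr. Qed.

Lemma tensor_addA : associative tensor_add.
Proof.
move=> x y z; rewrite -[x]reprK -[y]reprK -[z]reprK.
move: (repr x) (repr y) (repr z) => s t u.
by rewrite -(pi_cat t u) -(pi_cat s t) -(pi_cat s (t ++ u)) catA pi_cat.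
Qed.

Lemma tensor_addC : commutative tensor_add.
Proof. by move=> x y; apply/tensor_piP/TensorPerm; rewrite perm_catC. Qed.

Lemma tensor_add0 : left_id tensor_zero tensor_add.
Proof. by move=> x; rewrite -[x]reprK -pi_cat. Qed.

Lemma tensor_scaleDl x :
  {morph tensor_scale^~ x : c d / c + d >-> tensor_add c d}.
Proof.
move=> c d; rewrite -[x]reprK; move: (repr x) => s.
rewrite -!pi_scale -pi_cat; apply/tensor_piP.
elim: s => [|[a b] s IHs] /=; first exact: tensor_eq_refl.
rewrite scalerDl; apply: TensorTrans
  (tensor_eq_cat (TensorAddl (c *: a) (d *: a) b) IHs) _.
apply: TensorPerm; rewrite /= perm_cons.
by rewrite -cat1s perm_catCA.
Qed.

Lemma tensor_scale0 x : tensor_scale 0 x = tensor_zero.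
Proof.
rewrite -[x]reprK; move: (repr x) => s; rewrite -pi_scale; apply/tensor_piP.
elim: s => [|[a b] s IHs] /=; first exact: tensor_eq_refl.
by rewrite scale0r; apply: (tensor_eq_cat (TensorZero b) IHs).
Qed.

Lemma tensor_scale1 : left_id 1 tensor_scale.
Proof.
move=> x; rewrite -[x]reprK -pi_scale; congr (pi _).
by rewrite -[RHS]map_id; apply: eq_map => -[a b] /=; rewrite scale1r.
Qed.

Lemma tensor_scaleA c d x :
  tensor_scale c (tensor_scale d x) = tensor_scale (c * d) x.
Proof.
rewrite -[x]reprK; move: (repr x) => s.
rewrite -(pi_scale d) -(pi_scale c) -(pi_scale (c * d)); congr (pi _).
by rewrite /scale_formal -map_comp; apply: eq_map => -[a b] /=; rewrite scalerA.
Qed.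

Lemma tensor_scaleDr : right_distributive tensor_scale tensor_add.
Proof.
move=> c x y; rewrite -[x]reprK -[y]reprK.
move: (repr x) (repr y) => s t.
rewrite -(pi_cat s t) -(pi_scale c (s ++ t)) -(pi_scale c s) -(pi_scale c t).
by rewrite /scale_formal map_cat pi_cat.
Qed.

Lemma tensor_addN : left_inverse tensor_zero tensor_opp tensor_add.
Proof.
move=> x; rewrite -[X in tensor_add _ X]tensor_scale1 -tensor_scaleDl addNr.
exact: tensor_scale0.
Qed.

HB.instance Definition _ := GRing.isZmodule.Build tensor
  tensor_addA tensor_addC tensor_add0 tensor_addN.
HB.instance Definition _ := GRing.Zmodule_isLmodule.Build k tensor
  tensor_scaleA tensor_scale1 tensor_scaleDr tensor_scaleDl.

Lemma pi_pure s : pi s = \sum_(p <- s) pure p.1 p.2.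
Proof.
elim: s => [|[a b] s IHs]; first by rewrite big_nil.
by rewrite big_cons -IHs -cat1s pi_cat.
Qed.

Lemma tensor_pure x : exists s : seq (A * B), x = \sum_(p <- s) pure p.1 p.2.
Proof. by exists (repr x); rewrite -pi_pure reprK. Qed.

Lemma pure_bilinear : bilinear_for *:%R *:%R pure.
Proof.
have pureZl c a b : pure (c *: a) b = c *: pure a b.
  exact: (pi_scale c [:: (a, b)]).
split=> [b c a a' | a c b b'].
  rewrite /= -pureZl -[RHS](pi_cat [:: (c *: a, b)] [:: (a', b)]).
  exact/tensor_piP/TensorAddl.
rewrite /= -pureZl -[RHS](pi_cat [:: (c *: a, b)] [:: (a, b')]).
apply/tensor_piP.
apply: TensorTrans (TensorAddr _ _ _) _; apply/TensorSym.
exact: (tensor_eq_cat (TensorScale c a b) (tensor_eq_refl _)).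
Qed.

(* The linear map out of A ⊗ B induced by f; only meaningful for f bilinear. *)
Definition tensor_lift (C : lmodType k) (f : A -> B -> C) (x : tensor) : C :=
  \sum_(p <- repr x) f p.1 p.2.

Section Lift.
Variables (C : lmodType k) (f : A -> B -> C).
Hypothesis f_bilin : bilinear_for *:%R *:%R f.

Lemma bilin_addl a a' b : f (a + a') b = f a b + f a' b.
Proof. by have := f_bilin.1 b 1 a a'; rewrite /= !scale1r. Qed.

Lemma bilin_addr a b b' : f a (b + b') = f a b + f a b'.
Proof. by have := f_bilin.2 a 1 b b'; rewrite /= !scale1r. Qed.

Lemma bilin_zerol b : f 0 b = 0.
Proof. by apply: (addrI (f 0 b)); rewrite -bilin_addl !addr0. Qed.

Lemma bilin_zeror a : f a 0 = 0.
Proof. by apply: (addrI (f a 0)); rewrite -bilin_addr !addr0. Qed.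

Lemma bilin_scalel c a b : f (c *: a) b = c *: f a b.
Proof. by have := f_bilin.1 b c a 0; rewrite /= bilin_zerol !addr0. Qed.

Lemma bilin_scaler c a b : f a (c *: b) = c *: f a b.
Proof. by have := f_bilin.2 a c b 0; rewrite /= bilin_zeror !addr0. Qed.

Lemma bilin_formal s t : tensor_eq s t ->
  \sum_(p <- s) f p.1 p.2 = \sum_(p <- t) f p.1 p.2.
Proof.
elim=> {s t}.
- by move=> s t; apply: perm_big.
- by move=> s t _ ->.
- by move=> s t u _ -> _ ->.
- by move=> p s t _ IH; rewrite !big_cons IH.
- by move=> b; rewrite big_seq1 big_nil /= bilin_zerol.
- by move=> a a' b; rewrite !big_cons !big_nil /= !addr0 bilin_addl.
- by move=> a b b'; rewrite !big_cons !big_nil /= !addr0 bilin_addr.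
- by move=> c a b; rewrite !big_seq1 /= bilin_scalel bilin_scaler.
Qed.

Lemma tensor_lift_pi s : tensor_lift f (pi s) = \sum_(p <- s) f p.1 p.2.
Proof. exact/bilin_formal/tensor_repr. Qed.

Lemma tensor_lift_linear : linear (tensor_lift f).
Proof.
move=> c x y; rewrite -[x]reprK -[y]reprK.
move: (repr x) (repr y) => s t.
rewrite -[c *: _](pi_scale c s) -[_ + _](pi_cat (scale_formal c s) t).
rewrite !tensor_lift_pi big_cat /=.
rewrite big_map scaler_sumr; congr (_ + _).
by apply: eq_bigr => p _; rewrite bilin_scalel.
Qed.

Lemma tensor_lift_pure a b : tensor_lift f (pure a b) = f a b.
Proof. by rewrite tensor_lift_pi big_seq1. Qed.

End Lift.
End Tensor.

Notation "A ⊗ B" := (tensor A B) (at level 40, left associativity) : type_scope.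
Notation "a ⊗ b" := (pure a b) (at level 40, left associativity) : ring_scope.

Section TensorMap.
Variables (k : fieldType) (A B A' B' : lmodType k).
Variables (f : A -> A') (g : B -> B').
Hypotheses (f_lin : linear f) (g_lin : linear g).

Lemma tensor_map_bilinear :
  bilinear_for *:%R *:%R (fun a b => f a ⊗ g b).
Proof.
have pbl := @pure_bilinear _ A' B'.
split=> [b c a a' | a c b b'] /=; first by rewrite f_lin pbl.1.
by rewrite g_lin pbl.2.
Qed.

Lemma tensor_map_linear : linear (tensor_lift (fun a b => f a ⊗ g b)).
Proof. exact/tensor_lift_linear/tensor_map_bilinear. Qed.

Lemma tensor_map_pure a b :
  tensor_lift (fun a b => f a ⊗ g b) (a ⊗ b) = f a ⊗ g b.
Proof. exact/tensor_lift_pure/tensor_map_bilinear. Qed.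
End TensorMap.

Lemma tensor_lift_fun_linear (k : fieldType) (A B C D : lmodType k)
    (F : D -> A -> B -> C) x :
  (forall a b, linear (fun d => F d a b)) ->
  linear (fun d => tensor_lift (F d) x).
Proof.
move=> FL c d d'; rewrite /tensor_lift scaler_sumr -big_split.
by apply: eq_bigr => p _; rewrite FL.
Qed.

Section TensorVector.
Import VectorInternalTheory.
Variables (k : fieldType) (U V : vectType k).

Let coords (u : U) (v : V) : 'rV[k]_(dim U * dim V) :=
  mxvec ((v2r u)^T *m v2r v).

Let coords_bilinear : bilinear_for *:%R *:%R coords.
Proof.
split=> [v c u u' | u c v v']; rewrite /coords /= linearP.
  by rewrite linearP /= mulmxDl -scalemxAl linearP.
by rewrite mulmxDr -scalemxAr linearP.
Qed.

Fact tensor_vect_iso : Vector.axiom (dim U * dim V) (U ⊗ V)%type.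
Proof.
exists (tensor_lift coords); first exact: tensor_lift_linear.
pose e i : U := r2v (delta_mx 0 i); pose e' j : V := r2v (delta_mx 0 j).
pose g (w : 'rV[k]_(dim U * dim V)) : (U ⊗ V)%type :=
  \sum_i \sum_j vec_mx w i j *: (e i ⊗ e' j).
pose L := GRing.isLinear.Build _ _ _ _ _ (tensor_lift_linear coords_bilinear).
have [lft lftE] : exists l : {linear _ -> _}, l =1 tensor_lift coords.
  pose l : {linear _ -> _} := HB.pack (tensor_lift coords) L.
  by exists l.
have pbl := @pure_bilinear _ U V.
exists g => [x | w].
  have [s ->] := tensor_pure x.
  have gD : {morph g : w w' / w + w'}.
    move=> w w'; rewrite -big_split; apply: eq_bigr => i _.
    by rewrite -big_split; apply: eq_bigr => j _; rewrite linearD mxE scalerDl.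
  have g0 : g 0 = 0.
    rewrite /g big1 // => i _; rewrite big1 // => j _.
    by rewrite linear0 mxE scale0r.
  rewrite -lftE linear_sum (big_morph g gD g0).
  apply: eq_bigr => -[u v] _; rewrite lftE (tensor_lift_pure coords_bilinear).
  rewrite /g /coords mxvecK.
  have sumE (W : vectType k) (w : W) :
      w = \sum_i v2r w 0 i *: r2v (delta_mx 0 i).
    rewrite -[LHS]v2rK {1}[v2r w]row_sum_delta linear_sum.
    by apply: eq_bigr => i _; rewrite linearZ.
  rewrite [in RHS](sumE _ u) [in RHS](sumE _ v).
  rewrite (big_morph (fun u => u ⊗ _)
    (fun u u' => bilin_addl pbl u u' _) (bilin_zerol pbl _)).
  apply: eq_bigr => i _; rewrite (big_morph (fun v => _ ⊗ v)
    (fun v v' => bilin_addr pbl _ v v') (bilin_zeror pbl _)).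
  apply: eq_bigr => j _; rewrite (bilin_scalel pbl) (bilin_scaler pbl).
  by rewrite scalerA !mxE big_ord1 mxE.
rewrite -lftE /g linear_sum.
rewrite -[RHS]vec_mxK [in RHS](matrix_sum_delta (vec_mx w)) linear_sum.
apply: eq_bigr => i _; rewrite !linear_sum; apply: eq_bigr => j _.
rewrite !linearZ lftE (tensor_lift_pure coords_bilinear) /coords !r2vK.
by rewrite trmx_delta mul_delta_mx.
Qed.

HB.instance Definition _ :=
  Lmodule_hasFinDim.Build k (U ⊗ V)%type tensor_vect_iso.
End TensorVector.

Section Operad.
Variables (k : fieldType) (Omega : vectType k).

(* Ω^{⊗2} ⊕ Ω^{⊗2} *)
Definition quad : vectType k := ((Omega ⊗ Omega) * (Omega ⊗ Omega))%type.

Definition tsum (s : seq (Omega * Omega)) : (Omega ⊗ Omega)%type :=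
  \sum_(p <- s) p.1 ⊗ p.2.

Variable Lam : {vspace quad}.

Definition operations_linear (A : lmodType k) (op : Omega -> A -> A -> A) :=
  (forall a b, linear (fun o => op o a b)) /\
  (forall o, bilinear_for *:%R *:%R (op o)).

Definition is_algebra (A : lmodType k) (op : Omega -> A -> A -> A) :=
  operations_linear op /\
  forall s t : seq (Omega * Omega), (tsum s, tsum t) \in Lam ->
  forall x y z : A,
    \sum_(p <- s) op p.2 (op p.1 x y) z = \sum_(p <- t) op p.1 x (op p.2 y z).

(* A_+ = k1 ⊕ A: the pair (c, a) stands for c 1 + a. *)
Definition aug (A : lmodType k) : lmodType k := (k^o * A)%type.
Definition aug_one (A : lmodType k) : aug A := (1, 0).
Definition aug_in (A : lmodType k) (a : A) : aug A := (0, a).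

Variables (star : Omega) (alpha beta : 'Hom(Omega, k^o)).

Definition unit_action := alpha star = 1 /\ beta star = 1.

(* The partial operation of o on A_+.  By bilinearity x o y involves the term
   x.1 y.1 (1 o 1), so it is defined when this coefficient vanishes or when
   o = star, for which 1 o 1 = 1.  The value of ext_op is used only where
   ext_defined holds. *)
Definition ext_defined (A : lmodType k) (o : Omega) (x y : aug A) : bool :=
  (x.1 * y.1 == 0) || (o == star).
Definition ext_op (A : lmodType k) (op : Omega -> A -> A -> A) (o : Omega)
    (x y : aug A) : aug A :=
  (x.1 * y.1,
   op o x.2 y.2 + (alpha o * y.1 : k) *: x.2 + (beta o * x.1 : k) *: y.2).

(* All the representations of a relation as a pair of finite sums of pure
   tensors are considered; a side makes sense when all of its terms do. *)
Definition compatible :=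
  unit_action /\
  forall (A : lmodType k) (op : Omega -> A -> A -> A), is_algebra op ->
  forall s t : seq (Omega * Omega), (tsum s, tsum t) \in Lam ->
  forall x y z : aug A,
    (forall p, p \in s ->
       ext_defined p.1 x y /\ ext_defined p.2 (ext_op op p.1 x y) z) ->
    (forall p, p \in t ->
       ext_defined p.2 y z /\ ext_defined p.1 x (ext_op op p.2 y z)) ->
    \sum_(p <- s) ext_op op p.2 (ext_op op p.1 x y) z =
    \sum_(p <- t) ext_op op p.1 x (ext_op op p.2 y z).

Section Box.
Variables A B : lmodType k.
Variables (opA : Omega -> A -> A -> A) (opB : Omega -> B -> B -> B).

(* A ⊠ B: the triple (a, b, t) stands for a ⊗ 1 + 1 ⊗ b + t. *)
Definition box : lmodType k := (A * B * (A ⊗ B))%type.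

(* The A ⊠ B component of x ⊗ y, i.e. x ⊗ y with its multiple of 1 ⊗ 1
   dropped. *)
Definition box_pure (x : aug A) (y : aug B) : box :=
  (y.1 *: x.2, x.1 *: y.2, x.2 ⊗ y.2).

(* The operation of o on A ⊠ B, written out by bilinearity.  It is linear in o
   and in both arguments (box_op_linear), and its values on the tensors x ⊗ y,
   with each of x, y equal to 1 or in A, B, are those prescribed by
     (x ⊗ y) (x' ⊗ y') = (x star x') ⊗ (y o y')   if y ⊗ y' <> 1 ⊗ 1,
     (x ⊗ 1) (x' ⊗ 1)  = (x o x') ⊗ 1
   (box_op_pure and box_op_pure11). *)
Definition box_op (o : Omega) (x y : box) : box :=
  let a := x.1.1 in let b := x.1.2 in let t := x.2 in
  let a' := y.1.1 in let b' := y.1.2 in let t' := y.2 in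
  (opA o a a',
   opB o b b',
   (beta o : k) *: (a ⊗ b')
   + tensor_lift (fun a1 b1 => opA star a a1 ⊗ ((beta o : k) *: b1)) t'
   + (alpha o : k) *: (a' ⊗ b)
   + tensor_lift (fun a1 b1 => a1 ⊗ opB o b b1) t'
   + tensor_lift (fun a1 b1 => opA star a1 a' ⊗ ((alpha o : k) *: b1)) t
   + tensor_lift (fun a1 b1 => a1 ⊗ opB o b1 b') t
   + tensor_lift (fun a1 b1 =>
       tensor_lift (fun a2 b2 => opA star a1 a2 ⊗ opB o b1 b2) t') t).

Definition one_or_in (C : lmodType k) (x : aug C) :=
  x = aug_one C \/ exists c, x = aug_in c.

Hypotheses (linA : operations_linear opA) (linB : operations_linear opB).

Let idL (C : lmodType k) : linear (@id C). Proof. by []. Qed.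
Let scaleL (C : lmodType k) (c : k) : linear (fun x : C => c *: x).
Proof. by move=> d x y; rewrite scalerDr !scalerA mulrC. Qed.
Let opAl o a : linear (opA o a) := (proj2 linA o).2 a.
Let opAr o a : linear (opA o ^~ a) := (proj2 linA o).1 a.
Let opBl o b : linear (opB o b) := (proj2 linB o).2 b.
Let opBr o b : linear (opB o ^~ b) := (proj2 linB o).1 b.

Let pbl := @pure_bilinear k A B.

Let double_bilinear o t' : bilinear_for *:%R *:%R (fun a1 b1 =>
  tensor_lift (fun a2 b2 => opA star a1 a2 ⊗ opB o b1 b2) t').
Proof.
split=> [b | a]; apply: tensor_lift_fun_linear => a2 b2 c x y.
  by rewrite [opA _ _ _]opAr pbl.1.
by rewrite [opB _ _ _]opBr pbl.2.
Qed.

Let linear_zero (C D : lmodType k) (f : C -> D) : linear f -> f 0 = 0.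
Proof.
by move=> fL; have := fL (- 1) 0 0; rewrite scaler0 addr0 scaleN1r addNr.
Qed.

Let double_zero o t' : tensor_lift (fun a1 b1 =>
  tensor_lift (fun a2 b2 => opA star a1 a2 ⊗ opB o b1 b2) t') 0 = 0.
Proof. exact/linear_zero/tensor_lift_linear/double_bilinear. Qed.

Let map_zero (f : A -> A) (g : B -> B) : linear f -> linear g ->
  tensor_lift (fun a b => f a ⊗ g b) 0 = 0.
Proof. by move=> fL gL; apply: linear_zero (tensor_map_linear fL gL). Qed.

Let p0l b : (0 : A) ⊗ b = 0 := bilin_zerol pbl b.
Let p0r a : a ⊗ (0 : B) = 0 := bilin_zeror pbl a.
Let A0l o a : opA o 0 a = 0 := linear_zero (opAr o a).
Let A0r o a : opA o a 0 = 0 := linear_zero (opAl o a).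
Let B0l o b : opB o 0 b = 0 := linear_zero (opBr o b).
Let B0r o b : opB o b 0 = 0 := linear_zero (opBl o b).
Let simp := (p0l, p0r, A0l, A0r, B0l, B0r, scale0r, scaler0, scale1r,
  mulr0, mul0r, mulr1, mul1r, addr0, add0r).

Lemma box_op_linear : operations_linear box_op.
Proof.
have addL (C D : lmodType k) (f g : C -> D) :
    linear f -> linear g -> linear (fun x => f x + g x).
  by move=> fL gL c x y; rewrite fL gL scalerDr addrACA.
have pL (C : lmodType k) (f : C -> A) (b : B) :
    linear f -> linear (fun x => f x ⊗ b).
  by move=> fL c x y; rewrite fL pbl.1.
have pR (C : lmodType k) (f : C -> B) (a : A) :
    linear f -> linear (fun x => a ⊗ f x).
  by move=> fL c x y; rewrite fL pbl.2.
have formL (C : lmodType k) (f : 'Hom(Omega, k^o)) (c : C) :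
    linear (fun o => (f o : k) *: c).
  by move=> d o o'; rewrite linearP scalerDl scalerA.
have opoA a a' : linear (fun o => opA o a a') := linA.1 a a'.
have opoB b b' : linear (fun o => opB o b b') := linB.1 b b'.
have boxL (C : lmodType k) (f : C -> A) (g : C -> B) (h : C -> (A ⊗ B)%type) :
    linear f -> linear g -> linear h -> linear (fun x => (f x, g x, h x) : box).
  by move=> fL gL hL c x y; rewrite fL gL hL.
have compL (C D E : lmodType k) (f : D -> E) (g : C -> D) :
    linear f -> linear g -> linear (fun x => f (g x)).
  by move=> fL gL c x y; rewrite gL fL.
have projL1 : linear (fun x : box => x.1.1) by [].
have projL2 : linear (fun x : box => x.1.2) by [].
have projL3 : linear (fun x : box => x.2) by [].
split=> [x y | o].
  apply: boxL => //.
  do !apply: (addL).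
  - exact: formL.
  - apply: tensor_lift_fun_linear => a b; exact/pR/formL.
  - exact: formL.
  - apply: tensor_lift_fun_linear => a b; exact: pR.
  - apply: tensor_lift_fun_linear => a b; exact/pR/formL.
  - apply: tensor_lift_fun_linear => a b; exact: pR.
  - apply: tensor_lift_fun_linear => a b.
    apply: tensor_lift_fun_linear => a' b'; exact: pR.
split=> [y | x].
  apply: boxL.
  - exact: (compL _ _ _ _ _ (opAr _ _)).
  - exact: (compL _ _ _ _ _ (opBr _ _)).
  do !apply: (addL).
  - exact/compL/pL.
  - apply: tensor_lift_fun_linear => a b.
    apply: pL; exact: (compL _ _ _ _ _ (opAr _ _)).
  - exact/compL/pR.
  - apply: tensor_lift_fun_linear => a b.
    apply: pR; exact: (compL _ _ _ _ _ (opBr _ _)).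
  - by apply: compL => //; apply: tensor_map_linear.
  - by apply: compL => //; apply: tensor_map_linear.
  - by apply: compL => //; apply/tensor_lift_linear/double_bilinear.
apply: boxL.
- exact: (compL _ _ _ _ _ (opAl _ _)).
- exact: (compL _ _ _ _ _ (opBl _ _)).
do !apply: (addL).
- exact/compL/pR.
- by apply: compL => //; apply: tensor_map_linear.
- exact/compL/pL.
- by apply: compL => //; apply: tensor_map_linear.
- apply: tensor_lift_fun_linear => a b.
  apply: pL; exact: (compL _ _ _ _ _ (opAl _ _)).
- apply: tensor_lift_fun_linear => a b.
  apply: pR; exact: (compL _ _ _ _ _ (opBl _ _)).
- apply: tensor_lift_fun_linear => a b; apply: compL => //.
  exact: tensor_map_linear.
Qed.

Lemma box_op_pure (o : Omega) (x x' : aug A) (y y' : aug B) :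
  unit_action ->
  one_or_in x -> one_or_in x' -> one_or_in y -> one_or_in y' ->
  (x, y) != (aug_one A, aug_one B) -> (x', y') != (aug_one A, aug_one B) ->
  (y, y') != (aug_one B, aug_one B) ->
  box_op o (box_pure x y) (box_pure x' y') =
  box_pure (ext_op opA star x x') (ext_op opB o y y').
Proof.
have M := tensor_map_pure.
have D a b t' : tensor_lift (fun a1 b1 =>
    tensor_lift (fun a2 b2 => opA star a1 a2 ⊗ opB o b1 b2) t') (a ⊗ b) =
    tensor_lift (fun a2 b2 => opA star a a2 ⊗ opB o b b2) t'.
  exact/tensor_lift_pure/double_bilinear.
case=> alpha1 beta1.
move=> [-> | [a ->]] [-> | [a' ->]] [-> | [b ->]] [-> | [b' ->]];
  rewrite ?eqxx // => _ _ _;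
  rewrite /box_op /box_pure /ext_op /= ?simp ?alpha1 ?beta1 ?simp
    ?double_zero ?D ?map_zero ?M ?simp ?(bilin_scaler pbl) //;
  by [exact: opAl | exact: opAr | exact: opBl | exact: opBr | exact: scaleL].
Qed.

Lemma box_op_pure11 (o : Omega) (a a' : A) :
  box_op o (box_pure (aug_in a) (aug_one B)) (box_pure (aug_in a') (aug_one B))
  = box_pure (aug_in (opA o a a')) (aug_one B).
Proof.
rewrite /box_op /box_pure /= !simp double_zero ?map_zero ?simp //;
  by [exact: opAl | exact: opAr | exact: opBl | exact: opBr | exact: scaleL].
Qed.

End Box.

Definition coherent :=
  compatible /\
  forall (A B : lmodType k) (opA : Omega -> A -> A -> A)
         (opB : Omega -> B -> B -> B),
    is_algebra opA -> is_algebra opB -> is_algebra (box_op opA opB).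

End Operad.

Section Bases.
Variables (k : fieldType) (Omega : vectType k) (n : nat) (star : Omega).

(* In these lists o i is the i-th basis vector, numbered from 1, and
   index_iota i n.+1 is the range i, ..., n. *)
Implicit Type o : nat -> Omega.

Definition all_pairs (i0 : nat) o : seq (quad Omega) :=
  [seq (o i ⊗ o j, 0) | i <- index_iota i0 n.+1, j <- index_iota i0 n.+1] ++
  [seq (0, o i ⊗ o j) | i <- index_iota i0 n.+1, j <- index_iota i0 n.+1].

Definition coh_neq_basis o : seq (quad Omega) :=
  [:: (star ⊗ o 2, o 2 ⊗ o 2); (o 1 ⊗ o 1, o 1 ⊗ star)] ++
  [seq (o i ⊗ o 1, o i ⊗ o 1) | i <- index_iota 2 n.+1] ++
  [seq (o 2 ⊗ o j, o 2 ⊗ o j) | j <- index_iota 3 n.+1] ++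
  [seq (o 1 ⊗ o i, o i ⊗ o 2) | i <- index_iota 3 n.+1] ++
  all_pairs 3 o.

Definition coh_eq_basis o : seq (quad Omega) :=
  ((o 1 ⊗ star, o 1 ⊗ star) + (star ⊗ o 1, star ⊗ o 1)
    - (o 1 ⊗ o 1, o 1 ⊗ o 1)) ::
  all_pairs 2 o.

Definition comp_neq_basis o : seq (quad Omega) :=
  [:: ((o 1 + o 2) ⊗ o 2, o 2 ⊗ o 2); (o 1 ⊗ o 1, o 1 ⊗ (o 1 + o 2))] ++
  [seq (o i ⊗ o 1, o i ⊗ o 1) | i <- index_iota 2 n.+1] ++
  [seq (o 2 ⊗ o j, o 2 ⊗ o j) | j <- index_iota 3 n.+1] ++
  [seq (o 1 ⊗ o i, o i ⊗ o 2) | i <- index_iota 3 n.+1] ++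
  [seq (o i ⊗ o 2, 0) | i <- index_iota 3 n.+1] ++
  [seq (0, o 1 ⊗ o i) | i <- index_iota 3 n.+1] ++
  all_pairs 3 o.

Definition comp_eq_basis o : seq (quad Omega) :=
  (o 1 ⊗ o 1, o 1 ⊗ o 1) ::
  [seq (o 1 ⊗ o i, o 1 ⊗ o i) + (o i ⊗ o 1, o i ⊗ o 1)
    | i <- index_iota 2 n.+1] ++
  all_pairs 2 o.

(* The bound r <= n is there because the lists refer to the first r basis vectors
   individually (r = 2, or r = 1 when alpha = beta); with r = 1 it only excludes
   Omega = 0, which has no unit action. *)
Definition in_adapted_span (r : nat) (Lam : {vspace quad Omega})
    (L : (nat -> Omega) -> seq (quad Omega)) :=
  exists X : n.-tuple Omega,
    [/\ (r <= n)%N, basis_of fullv X, star = \sum_(o <- X) o &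
        exists2 W : {vspace quad Omega},
          basis_of W (L (fun i => X`_i.-1)) & (Lam <= W)%VS].

End Bases.

(* Main.v *)
Require Import Defs.
From HB Require Import structures.
From mathcomp Require Import all_boot all_order all_algebra.
From mathcomp Require Import ssrAC zify ring.

Set Implicit Arguments.
Unset Strict Implicit.
Unset Printing Implicit Defensive.

Import GRing.Theory.
Local Open Scope ring_scope.

(** The proof turns the two conditions on a unit action into linear equations
on a relation (L, R), and then checks that the listed vectors form a basis of
the solution space of these equations.

Compatibility. Substituting the unit for one of the three variables of a
relation leaves an expression in products of two elements. In the algebra
[free_module], which is generated by two elements and in which all products of
three elements vanish, the products of the two generators under independent
operations are independent; so each of the three substitutions gives an
equality in Omega, and these are the [one_unit_conditions]. Conversely they
are sufficient: substituting two or three units gives consequences of them,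
obtained by applying alpha or beta, because 1 o 1 makes sense for o = star
only, and alpha and beta are 1 there. This is [compatible_char].

Coherence. For three pure tensors of the box product whose B-components
involve no product 1 o 1, a relation reduces to the associativity of star on
A_+ and to the same relation on B_+, thus to compatibility. The components
1, 1, b and b, 1, 1 remain: there the product of the two elements with
component 1 is formed in A by the given operation instead of star, and the
relation becomes one of the two further equations [box_conditions]. This is
[coherent_char].

Bases. Let o_1, ..., o_n be a basis of Omega with sum star, and let alpha and
beta be its dual forms number a and b, where a = 1, b = 2, or a = b = 1 if
alpha = beta. Write L = sum l_ij o_i ⊗ o_j and R = sum r_ij o_i ⊗ o_j. For all
j, the one-unit conditions read l_bj = r_bj, l_aj = r_jb, l_ja = r_ja, and the
box conditions read l_jb = r_bb, r_aj = l_aa.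
Each generator in the four lists solves the equations and owns a
coordinate, in which it has entry 1 and all other generators of its list have
entry 0; and a solution that vanishes at all the owned coordinates is 0. So
the list is a basis of the solution space ([supported_span]).

Choice of the basis. Conversely, any unit action has such a basis: complete a
basis of the common kernel of alpha and beta by a vector o_1 with
alpha(o_1) = 1, beta(o_1) = 0 and by the vector o_2 that makes the sum equal
to star ([adapted_basis_neq], and [adapted_basis_eq] when alpha = beta). *)

(** * Families with dual coordinates *)
Section DualFamily.
Variables (k : fieldType) (V : vectType k) (T : eqType).
Variables (f : T -> {linear V -> k^o}) (s : seq (T * V)) (P : V -> Prop).
Hypothesis s_uniq : uniq (unzip1 s).
Hypothesis s_dual : {in s &, forall p q, f p.1 q.2 = (p.1 == q.1)%:R}.

Lemma dual_family_free : free (unzip2 s).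
Proof.
have [-> | [p0 _]] : s = [::] \/ exists p, p \in s.
- by case: (s) => [|p s']; [left | right; exists p; apply: mem_head].
- exact: nil_free.
apply/(@freeP _ _ _ (in_tuple (unzip2 s))) => c sum0 i.
have lt_sz (j : 'I_(size (unzip2 s))) : (j < size s)%N.
  by rewrite -(size_map snd).
have := congr1 (f (nth p0 s i).1) sum0; rewrite linear_sum linear0 => {}sum0.
rewrite -[RHS]sum0 (bigD1 i) //= big1 => [|j ne_ji].
  rewrite addr0 linearZ /= (nth_map p0) // s_dual ?mem_nth // eqxx.
  by rewrite /GRing.scale /= mulr1.
rewrite linearZ /= (nth_map p0) // s_dual ?mem_nth //.
rewrite -!(nth_map p0 p0.1 fst) // nth_uniq ?size_map // val_eqE eq_sym.
by rewrite (negbTE ne_ji) scaler0.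
Qed.

Hypothesis P0 : P 0.
Hypothesis P_linear : forall c u v, P u -> P v -> P (c *: u + v).
Hypothesis s_P : forall p, p \in s -> P p.2.
Hypothesis P_separated :
  forall w, P w -> (forall p, p \in s -> f p.1 w = 0) -> w = 0.

(** Subtracting from a solution w of P the combination of the family with the
same dual coordinates leaves a solution with all dual coordinates 0. *)
Lemma dual_family_span w : w \in <<unzip2 s>>%VS <-> P w.
Proof.
have Psum (I : eqType) (r : seq I) (c : I -> k) (v : I -> V) :
    (forall i, i \in r -> P (v i)) -> P (\sum_(i <- r) c i *: v i).
  elim: r => [|i r IHr] Pv; first by rewrite big_nil.
  rewrite big_cons; apply: P_linear; first by apply/Pv; rewrite mem_head.
  by apply: IHr => j rj; apply: Pv; rewrite inE rj orbT.
split=> [/(coord_span (X := in_tuple (unzip2 s))) -> | Pw].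
  apply: Psum => i _ /=.
  have /mapP[p sp ->] : (unzip2 s)`_i \in unzip2 s by rewrite mem_nth.
  exact: s_P.
pose v := \sum_(p <- s) f p.1 w *: p.2.
suff -> : w = v.
  rewrite /v big_seq; apply: rpred_sum => p sp.
  by rewrite rpredZ // memv_span //; apply: map_f.
apply/eqP; rewrite -subr_eq0; apply/eqP/P_separated.
  rewrite addrC -scaleN1r; apply: P_linear => //; exact: Psum.
move=> p sp; rewrite linearB linear_sum /=.
have s_uniq' := map_uniq s_uniq.
rewrite (bigD1_seq p) //= big_seq_cond big1 => [|q /andP[sq ne_qp]].
  rewrite addr0 linearZ /= s_dual // eqxx /GRing.scale /= mulr1; exact: subrr.
rewrite linearZ /= s_dual //.
have [eq_pq|_] := eqVneq p.1 q.1; last by rewrite scaler0.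
case/negP: ne_qp; apply/eqP.
have idx r : r \in s -> nth p s (index r.1 (unzip1 s)) = r.
  move=> sr; rewrite -{1}(nth_index p sr) -(nth_map p p.1 fst) ?index_mem //.
  by rewrite index_uniq ?size_map ?index_mem // nth_index.
by rewrite -(idx q sq) -eq_pq idx.
Qed.

End DualFamily.

(** * Contractions of tensors and sums of operations *)
Section Bilinear.
Variables (k : fieldType) (A B C : lmodType k) (f : A -> B -> C).
Hypothesis f_bilin : bilinear_for *:%R *:%R f.

Lemma bilin_suml (I : Type) (r : seq I) (F : I -> A) b :
  f (\sum_(i <- r) F i) b = \sum_(i <- r) f (F i) b.
Proof.
by apply: (big_morph (f^~ b)) => [a a'|];
  [apply: bilin_addl | apply: bilin_zerol].
Qed.

Lemma bilin_sumr (I : Type) (r : seq I) a (F : I -> B) :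
  f a (\sum_(i <- r) F i) = \sum_(i <- r) f a (F i).
Proof.
by apply: (big_morph (f a)) => [b b'|];
  [apply: bilin_addr | apply: bilin_zeror].
Qed.
End Bilinear.

Section Contraction.
Variables (k : fieldType) (U V : lmodType k).

(** Contractions express the result of putting a unit in a relation: a factor
of o o' that meets the unit is replaced by its value under alpha or beta. *)
Definition contr_left (f : {linear U -> k^o}) : (U ⊗ V)%type -> V :=
  tensor_lift (fun u v => (f u : k) *: v).
Definition contr_right (f : {linear V -> k^o}) : (U ⊗ V)%type -> U :=
  tensor_lift (fun u v => (f v : k) *: u).

Fact contr_left_bilinear (f : {linear U -> k^o}) :
  bilinear_for *:%R *:%R (fun u (v : V) => (f u : k) *: v).
Proof.
split=> [v c u u' | u c v v'] /=; first by rewrite linearP scalerDl scalerA.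
by rewrite scalerDr !scalerA mulrC.
Qed.

Fact contr_right_bilinear (f : {linear V -> k^o}) :
  bilinear_for *:%R *:%R (fun (u : U) v => (f v : k) *: u).
Proof.
split=> [v c u u' | u c v v'] /=; last by rewrite linearP scalerDl scalerA.
by rewrite scalerDr !scalerA mulrC.
Qed.

HB.instance Definition _ f := GRing.isLinear.Build _ _ _ _ (contr_left f)
  (tensor_lift_linear (contr_left_bilinear f)).
HB.instance Definition _ f := GRing.isLinear.Build _ _ _ _ (contr_right f)
  (tensor_lift_linear (contr_right_bilinear f)).

Lemma contr_left_pure f u v : contr_left f (u ⊗ v) = (f u : k) *: v.
Proof. exact: (tensor_lift_pure (contr_left_bilinear f)). Qed.

Lemma contr_right_pure f u v : contr_right f (u ⊗ v) = (f v : k) *: u.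
Proof. exact: (tensor_lift_pure (contr_right_bilinear f)). Qed.

Lemma contr_leftC (f : {linear U -> k^o}) (g : {linear V -> k^o}) t :
  g (contr_left f t) = f (contr_right g t).
Proof.
have [s ->] := tensor_pure t.
rewrite (linear_sum (contr_left f)) (linear_sum (contr_right g)) !linear_sum.
apply: eq_bigr => p _; rewrite /= contr_left_pure contr_right_pure !linearZ.
exact: mulrC.
Qed.

End Contraction.

Section Operations.
Variables (k : fieldType) (Omega : vectType k).

Lemma contr_left_tsum (f : {linear Omega -> k^o}) s :
  contr_left f (tsum s) = \sum_(p <- s) (f p.1 : k) *: p.2.
Proof.
by rewrite linear_sum; apply: eq_bigr => p _; apply: contr_left_pure.
Qed.

Lemma contr_right_tsum (f : {linear Omega -> k^o}) s :
  contr_right f (tsum s) = \sum_(p <- s) (f p.2 : k) *: p.1.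
Proof.
by rewrite linear_sum; apply: eq_bigr => p _; apply: contr_right_pure.
Qed.

Lemma quad_tsum (q : quad Omega) : exists s t, q = (tsum s, tsum t).
Proof.
case: q => L R; have [s ->] := tensor_pure L; have [t ->] := tensor_pure R.
by exists s, t.
Qed.

Section Algebra.
Variables (A : lmodType k) (op : Omega -> A -> A -> A).
Hypothesis op_linear : operations_linear op.

Lemma op_sum (I : Type) (r : seq I) (c : I -> k) (o : I -> Omega) a b :
  op (\sum_(i <- r) c i *: o i) a b = \sum_(i <- r) c i *: op (o i) a b.
Proof.
pose L := GRing.isLinear.Build _ _ _ _ _ (op_linear.1 a b).
pose l : {linear Omega -> A} := HB.pack (fun o => op o a b) L.
rewrite -[LHS]/(l _) linear_sum; apply: eq_bigr => i _.
by rewrite linearZ.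
Qed.

Lemma op_scale c o a b : op (c *: o) a b = c *: op o a b.
Proof.
by have := op_sum [:: tt] (fun=> c) (fun=> o) a b; rewrite !big_seq1.
Qed.

Lemma op_addl o a a' b : op o (a + a') b = op o a b + op o a' b.
Proof. exact: bilin_addl (op_linear.2 o) _ _ _. Qed.
Lemma op_addr o a b b' : op o a (b + b') = op o a b + op o a b'.
Proof. exact: bilin_addr (op_linear.2 o) _ _ _. Qed.
Lemma op_scalel o c a b : op o (c *: a) b = c *: op o a b.
Proof. exact: bilin_scalel (op_linear.2 o) _ _ _. Qed.
Lemma op_scaler o c a b : op o a (c *: b) = c *: op o a b.
Proof. exact: bilin_scaler (op_linear.2 o) _ _ _. Qed.
Lemma op_zerol o b : op o 0 b = 0.
Proof. exact: bilin_zerol (op_linear.2 o) _. Qed.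
Lemma op_zeror o a : op o a 0 = 0.
Proof. exact: bilin_zeror (op_linear.2 o) _. Qed.
End Algebra.

(** A quotient of the free algebra on two generators, (1, 0, 0) and (0, 1, 0),
that keeps of their products only those of the first by the second: under o
this is o itself, in the third component. *)
Definition free_module : lmodType k := (k^o * k^o * Omega)%type.
Definition free_op (o : Omega) (x y : free_module) : free_module :=
  (0, 0, ((x.1.1 : k) * (y.1.2 : k)) *: o).

(** Products of three elements vanish, so every quadratic relation holds. *)
Lemma free_op_algebra Lam : is_algebra Lam free_op.
Proof.
split; last first.
  move=> s t _ x y z; rewrite !big1 // => p _; rewrite /free_op /=.
    by rewrite mulr0 scale0r.
  by rewrite mul0r scale0r.
have pair_ext (x y : free_module) :
    x.1.1 = y.1.1 -> x.1.2 = y.1.2 -> x.2 = y.2 -> x = y.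
  by case: x y => [[? ?] ?] [[? ?] ?] /= -> -> ->.
split=> [a b c o o' | o].
  apply: pair_ext; rewrite /= ?scaler0 ?addr0 //.
  by rewrite scalerDr !scalerA [c * _]mulrC.
split=> [b c a a' | a c b b']; apply: pair_ext; rewrite /= ?scaler0 ?addr0 //.
  by rewrite mulrDl scalerDl scalerA mulrA.
by rewrite mulrDr scalerDl scalerA [c *: _]/(c * _) mulrCA.
Qed.
End Operations.

(** * Unit actions that are compatible *)
Section Units.
Variables (k : fieldType) (Omega : vectType k) (star : Omega).
Variables (alpha beta : 'Hom(Omega, k^o)).

(** The three equations come from a relation by putting the unit in place of
the first, the second and the third variable. *)
Definition one_unit_conditions (q : quad Omega) : Prop :=
  [/\ contr_left beta q.1 = contr_left beta q.2,
      contr_left alpha q.1 = contr_right beta q.2 &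
      contr_right alpha q.1 = contr_right alpha q.2].

(** The first equation comes from the relation on a ⊗ 1, a' ⊗ 1, 1 ⊗ b in
the box product, the second one from 1 ⊗ b, a ⊗ 1, a' ⊗ 1. *)
Definition box_conditions (q : quad Omega) : Prop :=
  contr_right beta q.1 = (beta (contr_left beta q.2) : k) *: star /\
  contr_left alpha q.2 = (alpha (contr_left alpha q.1) : k) *: star.

Variable Lam : {vspace quad Omega}.

(** In [free_module] the two generators u, v have independent products u o v, so
the third components of the three substitutions are the three equations. *)
Lemma compatible_one_unit q :
  compatible Lam star alpha beta -> q \in Lam -> one_unit_conditions q.
Proof.
have [s [t ->]] := quad_tsum q => -[_ compat] Lam_st.
pose u : free_module Omega := (1, 0, 0).
pose v : free_module Omega := (0, 1, 0).
have uv x y z : (x.1 * y.1 == 0 :> k) -> (y.1 * z.1 == 0 :> k) ->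
    (\sum_(p <- s) ext_op alpha beta (@free_op k Omega) p.2
       (ext_op alpha beta (@free_op k Omega) p.1 x y) z).2.2 =
    (\sum_(p <- t) ext_op alpha beta (@free_op k Omega) p.1 x
       (ext_op alpha beta (@free_op k Omega) p.2 y z)).2.2.
  move=> xy yz; rewrite (compat _ _ (free_op_algebra Lam) s t) //.
    move=> p _; rewrite /ext_defined xy /= (eqP xy).
    by rewrite mul0r eqxx.
  by move=> p _; rewrite /ext_defined yz /= (eqP yz) mulr0 eqxx.
have sum22 (I : Type) (r : seq I) (F : I -> aug (free_module Omega)) :
    (\sum_(i <- r) F i).2.2 = \sum_(i <- r) (F i).2.2.
  by rewrite !raddf_sum.
have scaleA (c : k) : c *: (1 : k^o) = c := mulr1 c.
have simp := (scaleA, mulr0, mul0r, mulr1, mul1r, scale0r, scaler0, scale1r,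
  addr0, add0r).
split; rewrite ?contr_left_tsum ?contr_right_tsum.
- have := uv (aug_one _) (aug_in u) (aug_in v); rewrite !sum22 /= !simp eqxx.
  move=> /(_ isT isT) e; apply: etrans (etrans _ e) _;
    apply: eq_bigr => p _ /=; rewrite !simp //.
- have := uv (aug_in u) (aug_one _) (aug_in v); rewrite !sum22 /= !simp eqxx.
  move=> /(_ isT isT) e; apply: etrans (etrans _ e) _;
    apply: eq_bigr => p _ /=; rewrite !simp //.
- have := uv (aug_in u) (aug_in v) (aug_one _); rewrite !sum22 /= !simp eqxx.
  move=> /(_ isT isT) e; apply: etrans (etrans _ e) _;
    apply: eq_bigr => p _ /=; rewrite !simp //.
Qed.

(** By multilinearity only the coefficients at x, y, z in A and at the unit
matter. The expansion of either side has seven terms: the product of three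
elements of A, for which the relation of the algebra is used, three with one
unit, which are the one-unit conditions, and three with two units, which are
images of these conditions under alpha or beta. The assumptions on s and t say
that a product 1 o 1 enters only with beta(o) = 1, resp. alpha(o) = 1, and
allow its value 1 to be replaced by beta(o), resp. alpha(o). *)
Lemma ext_op_relation (A : lmodType k) (op : Omega -> A -> A -> A) s t :
  is_algebra Lam op -> (tsum s, tsum t) \in Lam ->
  one_unit_conditions (tsum s, tsum t) ->
  forall x y z : aug A,
    (forall p, p \in s -> (x.1 * y.1 == 0 :> k) || (beta p.1 == 1 :> k)) ->
    (forall p, p \in t -> (y.1 * z.1 == 0 :> k) || (alpha p.2 == 1 :> k)) ->
    (\sum_(p <- s) ext_op alpha beta op p.2 (ext_op alpha beta op p.1 x y) z).2
    = (\sum_(p <- t)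
         ext_op alpha beta op p.1 x (ext_op alpha beta op p.2 y z)).2.
Proof.
case=> op_lin op_rel Lam_st [/= cx cy cz] x y z s_def t_def.
have linM (f : 'Hom(Omega, k^o)) c o : f (c *: o) = (c * f o : k).
  exact: linearZ.
(* the left side depends on s only through sums that occur in the conditions *)
have lhsE : (\sum_(p <- s)
      ext_op alpha beta op p.2 (ext_op alpha beta op p.1 x y) z).2 =
   \sum_(p <- s) op p.2 (op p.1 x.2 y.2) z.2
   + (y.1 : k) *: op (contr_left alpha (tsum s)) x.2 z.2
   + (x.1 : k) *: op (contr_left beta (tsum s)) y.2 z.2
   + (z.1 : k) *: op (contr_right alpha (tsum s)) x.2 y.2
   + (z.1 * y.1 * alpha (contr_right alpha (tsum s)) : k) *: x.2
   + (z.1 * x.1 * alpha (contr_left beta (tsum s)) : k) *: y.2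
   + (x.1 * y.1 * beta (contr_left beta (tsum s)) : k) *: z.2.
  rewrite raddf_sum !contr_left_tsum !contr_right_tsum !op_sum //.
  rewrite !linear_sum !mulr_sumr !scaler_suml ?scaler_sumr.
  rewrite -!big_split; rewrite big_seq [RHS]big_seq; apply: eq_bigr => p sp /=.
  rewrite !op_addl // !op_scalel // !scalerDr !scalerA !addrA !linM.
  congr (_ + _ *: _ + _ *: _ + _ *: _ + _ *: _ + _ *: _ + _ *: _); try by ring.
  case/orP: (s_def p sp) => /eqP ->; last by ring.
  by rewrite mulr0 mul0r.
rewrite lhsE cx cy cz {lhsE}; apply/esym.
rewrite [LHS]raddf_sum !contr_left_tsum !contr_right_tsum !op_sum //.
rewrite !linear_sum !mulr_sumr !scaler_suml ?scaler_sumr.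
rewrite (op_rel s t) // -!big_split big_seq [RHS]big_seq.
apply: eq_bigr => p tp /=.
rewrite !op_addr // !op_scaler // !scalerDr !scalerA !addrA !linM.
(* the terms of the right side come with the unit in z before that in y *)
rewrite [RHS](ACl (1*4*2*5*3*6*7)).
congr (_ + _ *: _ + _ *: _ + _ *: _ + _ *: _ + _ *: _ + _ *: _); try by ring.
case/orP: (t_def p tp) => [yz|/eqP ->]; last by ring.
by rewrite (eqP yz) [z.1 * y.1]mulrC (eqP yz) mulr0 mul0r.
Qed.

(** The coefficient of the unit needs an argument of its own: if it does not
vanish, then both sides of the relation consist of copies of star star only,
and the first condition, evaluated by beta, says that the numbers of copies
agree in k. *)
Lemma compatible_char :
  compatible Lam star alpha beta <->
  unit_action star alpha beta /\ forall q, q \in Lam -> one_unit_conditions q.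
Proof.
split=> [compat | [[alpha1 beta1] conds]].
  by split=> [|q Lam_q]; [case: compat | apply: compatible_one_unit].
split=> // A op op_alg s t Lam_st x y z s_def t_def.
have st_conds := conds _ Lam_st.
have snd_eq := ext_op_relation op_alg Lam_st st_conds.
apply/eqP; rewrite -pair_eqE; apply/andP; split; apply/eqP; last first.
  apply: snd_eq => p in_p.
    by have [/orP[->|/eqP->] _] := s_def p in_p; rewrite ?beta1 ?eqxx ?orbT.
  by have [/orP[->|/eqP->] _] := t_def p in_p; rewrite ?alpha1 ?eqxx ?orbT.
rewrite !raddf_sum /=.
have [xyz0|xyz0] := eqVneq (x.1 * y.1 * z.1 : k) 0.
  rewrite !big1 // => p _.
  by rewrite -[LHS]/(x.1 * (y.1 * z.1) : k) mulrA.
have [xy0 yz0] : (x.1 * y.1 != 0 :> k) /\ (y.1 * z.1 != 0 :> k).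
  by move: xyz0; rewrite !mulf_eq0 !negb_or => /andP[/andP[-> ->] ->].
have s_star p : p \in s -> p = (star, star).
  case: p => p1 p2 /s_def[]; rewrite /ext_defined /= (negbTE xy0) (negbTE xyz0).
  by move=> /eqP-> /eqP->.
have t_star p : p \in t -> p = (star, star).
  case: p => p1 p2 /t_def[]; rewrite /ext_defined /= mulrA (negbTE yz0).
  by rewrite (negbTE xyz0) => /eqP-> /eqP->.
have [/= cx _ _] := st_conds.
have := congr1 (fun o => x.1 * y.1 * z.1 * beta o : k) cx.
rewrite !contr_left_tsum !linear_sum !mulr_sumr => e.
apply: etrans (etrans _ e) _; rewrite big_seq [RHS]big_seq;
  apply: eq_bigr => p in_p.
  by rewrite (s_star p in_p) /= beta1 scale1r beta1 mulr1.
by rewrite (t_star p in_p) /= beta1 scale1r beta1 mulr1 mulrA.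
Qed.
End Units.

(** * Unit actions that are coherent *)
Section Boxes.
Variables (k : fieldType) (Omega : vectType k) (star : Omega).
Variables (alpha beta : 'Hom(Omega, k^o)) (Lam : {vspace quad Omega}).

Local Notation ext := (ext_op alpha beta).

Lemma ext_op_one_in (A : lmodType k) (op : Omega -> A -> A -> A) o a :
  operations_linear op ->
  ext op o (aug_one A) (aug_in a) = aug_in ((beta o : k) *: a).
Proof.
move=> op_lin; rewrite /ext_op /aug_in /= op_zerol // !mulr1 !mulr0 scale0r.
by rewrite ?addr0 ?add0r.
Qed.

Lemma ext_op_in_one (A : lmodType k) (op : Omega -> A -> A -> A) o a :
  operations_linear op ->
  ext op o (aug_in a) (aug_one A) = aug_in ((alpha o : k) *: a).
Proof.
move=> op_lin; rewrite /ext_op /aug_in /= op_zeror // !mulr1 !mulr0 scale0r.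
by rewrite ?mul0r ?addr0 ?add0r.
Qed.

Lemma ext_op_in_in (A : lmodType k) (op : Omega -> A -> A -> A) o a b :
  ext op o (aug_in a) (aug_in b) = aug_in (op o a b).
Proof. by rewrite /ext_op /aug_in /= !mulr0 !scale0r !addr0. Qed.

Lemma aug_in_linear (A : lmodType k) : linear (@aug_in k A).
Proof. by move=> c a b; congr (_, _); rewrite /= scaler0 addr0. Qed.

Lemma ext_op_bilinear (A : lmodType k) (op : Omega -> A -> A -> A) o :
  operations_linear op -> bilinear_for *:%R *:%R (ext op o).
Proof.
move=> op_lin; have scaleE (c d : k) : c *: (d : k^o) = c * d by [].
split=> [y c x x' | x c y y']; rewrite /ext_op /=.
  congr (_, _); first by rewrite mulrDl -mulrA.
  rewrite op_addl // op_scalel //= scaleE !scalerDr !scalerA mulrDr scalerDl.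
  rewrite !addrA [RHS](ACl (1*4*2*5*3*6)) /=.
  by congr (_ + _ *: _ + _ + _ *: _ + _); ring.
congr (_, _); first by rewrite mulrDr mulrCA.
rewrite op_addr // op_scaler //= scaleE !scalerDr !scalerA mulrDr scalerDl.
rewrite !addrA [RHS](ACl (1*4*2*5*3*6)) /=.
by congr (_ + _ *: _ + _ + _ *: _ + _); ring.
Qed.

Section Boxing.
Variables (A B : lmodType k).
Variables (opA : Omega -> A -> A -> A) (opB : Omega -> B -> B -> B).
Hypotheses (linA : operations_linear opA) (linB : operations_linear opB).
Hypothesis unital : unit_action star alpha beta.

(** A product of two scalar components vanishes unless both elements are 1, so
the hypotheses exclude 1 ⊗ 1 as an argument and 1 o 1 as a product in B_+. *)
Lemma box_op_ext o (x x' : aug A) (y y' : aug B) :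
    one_or_in x -> one_or_in x' -> one_or_in y -> one_or_in y' ->
    (x.1 * y.1 = 0 :> k) -> (x'.1 * y'.1 = 0 :> k) -> (y.1 * y'.1 = 0 :> k) ->
  box_op star alpha beta opA opB o (box_pure x y) (box_pure x' y') =
  box_pure (ext opA star x x') (ext opB o y y').
Proof.
have neq (C D : lmodType k) (z : aug C) (w : aug D) : (z.1 * w.1 = 0 :> k) ->
    (z, w) != (aug_one C, aug_one D).
  move=> zw; apply: contraTneq isT => -[ez ew]; have := zw.
  by rewrite ez ew /= mulr1 => /eqP; rewrite oner_eq0.
by move=> *; apply: box_op_pure => //; apply: neq.
Qed.

Lemma one_or_in_star (x x' : aug A) :
  one_or_in x -> one_or_in x' -> one_or_in (ext opA star x x').
Proof.
case: unital => alpha1 beta1.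
case=> [-> | [a ->]] [-> | [a' ->]].
- left; rewrite /ext_op /aug_one /= op_zerol // !scaler0 !addr0 mulr1 //.
- by right; rewrite ext_op_one_in //; eexists.
- by right; rewrite ext_op_in_one //; eexists.
- by right; rewrite ext_op_in_in //; eexists.
Qed.

Lemma one_or_in_ext o (y y' : aug B) :
  (y.1 * y'.1 = 0 :> k) -> one_or_in (ext opB o y y').
Proof.
by move=> yy'; right; exists (ext opB o y y').2; rewrite /ext_op yy'.
Qed.

(** An identity that is additive in each variable can be checked on the pure
tensors x ⊗ y with x, y equal to 1 or to an element of A, B. *)
Lemma box_ind (P : box A B -> Prop) :
    P 0 -> (forall u v, P u -> P v -> P (u + v)) ->
    (forall x y, one_or_in x -> one_or_in y -> (x.1 * y.1 = 0 :> k) ->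
       P (box_pure x y)) ->
  forall w, P w.
Proof.
move=> P0 PD Ppure [[a b] t].
have pbl := @pure_bilinear _ A B.
have -> : ((a, b, t) : box A B) = (a, 0, 0) + (0, b, 0) + (0, 0, t).
  by congr (_, _, _); rewrite /= ?addr0 ?add0r.
apply: (PD); first apply: PD.
- have := Ppure (aug_in a) (aug_one B) (or_intror _ (ex_intro _ a erefl))
    (or_introl _ erefl) (mul0r _).
  by rewrite /box_pure /= scale1r scale0r (bilin_zeror pbl).
- have := Ppure (aug_one A) (aug_in b) (or_introl _ erefl)
    (or_intror _ (ex_intro _ b erefl)) (mulr0 _).
  by rewrite /box_pure /= scale1r scale0r (bilin_zerol pbl).
have [s ->] := tensor_pure t.
elim: s => [|p s IHs]; first by rewrite big_nil.
rewrite big_cons.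
have -> u v : ((0, 0, u + v) : box A B) = (0, 0, u) + (0, 0, v).
  by congr (_, _, _); rewrite /= addr0.
apply: PD IHs.
have := Ppure (aug_in p.1) (aug_in p.2) (or_intror _ (ex_intro _ _ erefl))
    (or_intror _ (ex_intro _ _ erefl)) (mulr0 _).
by rewrite /box_pure /= !scale0r.
Qed.

Lemma box_pure_bilinear : bilinear_for *:%R *:%R (@box_pure k A B).
Proof.
have pbl := @pure_bilinear _ A B.
split=> [y c x x' | x c y y']; rewrite /box_pure /= ?pbl.1 ?pbl.2.
  by congr (_, _, _); rewrite /= ?scalerDr ?scalerDl !scalerA // mulrC.
by congr (_, _, _); rewrite /= ?scalerDr ?scalerDl !scalerA // mulrC.
Qed.
End Boxing.

Hypothesis star_assoc : (star ⊗ star, star ⊗ star) \in Lam.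

(** Both factors are the algebra [free_module], and the form w |-> w.1.1, which
is 1 at u, turns a tensor in A ⊗ B into an element of A. *)
Lemma coherent_box_conditions q :
  coherent Lam star alpha beta -> q \in Lam -> box_conditions star alpha beta q.
Proof.
have [s [t ->]] := quad_tsum q => -[[unital _] box_alg] Lam_st.
pose F := free_module Omega; pose u : F := (1, 0, 0); pose v : F := (0, 1, 0).
pose op := @free_op k Omega; have op_alg := free_op_algebra Lam.
have op_lin : operations_linear op := (op_alg).1.
have [box_lin box_rel] := box_alg _ _ _ _ op_alg op_alg.
pose f : F -> F -> F := fun x y => (y.1.1 : k) *: x.
have f_bilin : bilinear_for *:%R *:%R f.
  split=> [y c x x' | x c y y'] /=; first by rewrite /f scalerDr !scalerA mulrC.
  by rewrite /f scalerDl !scalerA.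
have one1 (C : lmodType k) : one_or_in (aug_one C) by left.
have in1 (C : lmodType k) (c : C) : one_or_in (aug_in c) by right; exists c.
pose a := box_pure (aug_in u) (aug_one F).
pose a' := box_pure (aug_in v) (aug_one F).
pose b := box_pure (aug_one F) (aug_in u).
have gE (I : Type) (r : seq I) (X Y : I -> F) :
    (tensor_lift f (\sum_(i <- r) box_pure (aug_in (X i)) (aug_in (Y i))).2).2
    = \sum_(i <- r) ((Y i).1.1 : k) *: (X i).2.
  pose g (w : box F F) := (tensor_lift f w.2).2.
  have gL := tensor_lift_linear f_bilin.
  rewrite -/(g _) (big_morph g (id1 := 0) (op1 := +%R)) => [|w w'|].
  - by apply: eq_bigr => i _; rewrite /g /= tensor_lift_pure.
  - by have := gL 1 w.2 w'.2; rewrite !scale1r /g /= => ->.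
  - by have := gL (-1) 0 0; rewrite scaler0 addr0 scaleN1r addNr /g /= => ->.
have linE (h : 'Hom(Omega, k^o)) c o : h (c *: o) = (c * h o : k).
  exact: linearZ.
have scaleE (c d : k) : c *: (d : k^o) = c * d by [].
have [alpha1 beta1] := unital.
split.
- have := box_rel s t Lam_st a a' b.
  under eq_bigr => p _ do rewrite box_op_pure11 // box_op_ext
    ?ext_op_one_in ?ext_op_in_one //= ?alpha1 ?mulr0 ?mul0r //.
  under [RHS]eq_bigr => p _ do rewrite box_op_ext
    ?ext_op_one_in ?ext_op_in_one //= ?alpha1 ?mulr0 ?mul0r // box_op_ext
    ?ext_op_one_in ?ext_op_in_in //= ?alpha1 ?mulr0 ?mul0r //.
  move/(congr1 (fun w => (tensor_lift f w.2).2)); rewrite !gE => e.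
  rewrite contr_left_tsum contr_right_tsum linear_sum scaler_suml.
  apply: etrans (etrans _ e) _; apply: eq_bigr => p _ /=.
    by rewrite mulr1 !scale1r scaleE mulr1.
  by rewrite linE !scaleE mulr1 !mul1r scale1r.
have := box_rel s t Lam_st b a a'.
under eq_bigr => p _ do rewrite box_op_ext
  ?ext_op_one_in ?ext_op_in_one //= ?beta1 ?mulr0 ?mul0r // box_op_ext
  ?ext_op_one_in ?ext_op_in_one ?ext_op_in_in //= ?alpha1 ?mulr0 ?mul0r //.
under [RHS]eq_bigr => p _ do rewrite box_op_pure11 // box_op_ext
  ?ext_op_one_in ?ext_op_in_one //= ?beta1 ?mulr0 ?mul0r //.
move/(congr1 (fun w => (tensor_lift f w.2).2)); rewrite !gE => e.
rewrite !contr_left_tsum linear_sum scaler_suml.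
apply: etrans (etrans _ (esym e)) _; apply: eq_bigr => p _ /=.
  by rewrite mulr1 !scale1r scaleE mulr1.
by rewrite linE !scaleE mulr1 !mul1r scale1r mulrC.
Qed.

(** After reduction to pure tensors, the case where y y' and y' y'' are not
1 o 1 follows from compatibility in each factor. If y' = 1 and one of its
neighbours is 1 as well, the three remaining cases are y = y' = y'' = 1, which
is the relation in A, and the two cases covered by [box_conditions]. *)
Lemma box_algebra (A B : lmodType k) (opA : Omega -> A -> A -> A)
    (opB : Omega -> B -> B -> B) :
    compatible Lam star alpha beta ->
    (forall q, q \in Lam -> box_conditions star alpha beta q) ->
    is_algebra Lam opA -> is_algebra Lam opB ->
  is_algebra Lam (box_op star alpha beta opA opB).
Proof.
move=> [unital compat] conds algA algB.
have [linA relA] := algA; have [linB relB] := algB.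
have linBox := box_op_linear star alpha beta linA linB.
split=> // s t Lam_st; set op := box_op _ _ _ _ _.
have gen x y x' y' x'' y'' :
    one_or_in x -> one_or_in y -> (x.1 * y.1 = 0 :> k) ->
    one_or_in x' -> one_or_in y' -> (x'.1 * y'.1 = 0 :> k) ->
    one_or_in x'' -> one_or_in y'' -> (x''.1 * y''.1 = 0 :> k) ->
    \sum_(p <- s)
      op p.2 (op p.1 (box_pure x y) (box_pure x' y')) (box_pure x'' y'') =
    \sum_(p <- t)
      op p.1 (box_pure x y) (op p.2 (box_pure x' y') (box_pure x'' y'')).
  move=> ox oy xy ox' oy' xy' ox'' oy'' xy''.
  have unit_in (C : lmodType k) (z : aug C) : one_or_in z ->
      (z.1 = 1 :> k) -> z = aug_one C.
    by case=> [-> // | [c ->]] /= /eqP; rewrite eq_sym oner_eq0.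
  have one_in (C D : lmodType k) (z : aug C) (w : aug D) : one_or_in z ->
      w = aug_one D -> (z.1 * w.1 = 0 :> k) -> exists c, z = aug_in c.
    case=> [-> -> /= | [c ->] _ _]; last by exists c.
    by rewrite mulr1 => /eqP; rewrite oner_eq0.
  have ext_starA : ext opA star (ext opA star x x') x'' =
      ext opA star x (ext opA star x' x'').
    have := compat _ _ algA [:: (star, star)] [:: (star, star)].
    rewrite /tsum !big_seq1 => /(_ star_assoc x x' x''); rewrite !big_seq1.
    by apply=> p; rewrite inE => /eqP ->; rewrite /ext_defined eqxx !orbT.
  have ox_x' := one_or_in_star linA unital ox ox'.
  have ox'_x'' := one_or_in_star linA unital ox' ox''.
  have regular : (y.1 * y'.1 = 0 :> k) -> (y'.1 * y''.1 = 0 :> k) ->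
    \sum_(p <- s)
      op p.2 (op p.1 (box_pure x y) (box_pure x' y')) (box_pure x'' y'') =
    \sum_(p <- t)
      op p.1 (box_pure x y) (op p.2 (box_pure x' y') (box_pure x'' y'')).
    move=> yy' yy''.
    have oy_y' o := one_or_in_ext opB o yy'.
    have oy'_y'' o := one_or_in_ext opB o yy''.
    have yy'0 o : ((ext opB o y y').1 = 0 :> k) := yy'.
    have yy''0 o : ((ext opB o y' y'').1 = 0 :> k) := yy''.
    under eq_bigr => p _ do
      rewrite /op box_op_ext // box_op_ext ?yy'0 ?mulr0 ?mul0r //.
    under [RHS]eq_bigr => p _ do
      rewrite /op box_op_ext // box_op_ext ?yy''0 ?mulr0 ?mul0r //.
    rewrite -!(bilin_sumr (box_pure_bilinear A B)) ext_starA.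
    congr (box_pure _ _).
    apply: compat => // p _; rewrite /ext_defined /= ?yy' ?yy'' ?mulr0 ?mul0r;
      by rewrite eqxx.
  have dich z : one_or_in z -> z = aug_one B \/ exists b, z = aug_in b by [].
  have [y'1 | [b' y'E]] := dich y' oy'; last first.
    by apply: regular; rewrite y'E /= ?mulr0 ?mul0r.
  have [a' x'E] := one_in _ _ _ _ ox' y'1 xy'.
  have pbl := box_pure_bilinear A B.
  have ext_bl := ext_op_bilinear star linA.
  have aug_in0 (C : lmodType k) : aug_in (0 : C) = 0 by [].
  have aug_inD (C : lmodType k) (c c' : C) :
      aug_in (c + c') = aug_in c + aug_in c'.
    by have := aug_in_linear 1 c c'; rewrite !scale1r.
  have aug_inZ (C : lmodType k) c (d : C) : aug_in (c *: d) = c *: aug_in d.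
    by have := aug_in_linear c d 0; rewrite aug_in0 !addr0.
  have [conds_s conds_t] := conds _ Lam_st.
  have in_one_or_in (C : lmodType k) (c : C) : one_or_in (aug_in c).
    by right; exists c.
  have one_one_or_in (C : lmodType k) : one_or_in (aug_one C) by left.
  have linE (f : 'Hom(Omega, k^o)) c o : f (c *: o) = (c * f o : k).
    exact: linearZ.
  have [y1 | [b yE]] := dich y oy; have [y''1 | [b'' y''E]] := dich y'' oy''.
  (* y = y' = y'' = 1 *)
  - have [a xE] := one_in _ _ _ _ ox y1 xy.
    have [a'' x''E] := one_in _ _ _ _ ox'' y''1 xy''.
    rewrite y1 y'1 y''1 xE x'E x''E.
    under eq_bigr => p _ do rewrite /op !box_op_pure11 //.
    under [RHS]eq_bigr => p _ do rewrite /op !box_op_pure11 //.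
    have sumE (I : Type) (r : seq I) (F : I -> A) :
        \sum_(i <- r) box_pure (aug_in (F i)) (aug_one B) =
        box_pure (aug_in (\sum_(i <- r) F i)) (aug_one B).
      apply/esym/(big_morph (fun a => box_pure (aug_in a) (aug_one B))).
        by move=> c c'; rewrite aug_inD (bilin_addl pbl).
      by rewrite aug_in0 (bilin_zerol pbl).
    by rewrite !sumE (relA s t).
  (* y = y' = 1: both sides are images of elements of A under h *)
  - have [a xE] := one_in _ _ _ _ ox y1 xy.
    rewrite y1 y'1 y''E xE x'E.
    pose h a0 := box_pure (ext opA star (aug_in a0) x'') (aug_in b'').
    have hD a0 a1 : h (a0 + a1) = h a0 + h a1.
      by rewrite /h aug_inD (bilin_addl ext_bl) (bilin_addl pbl).
    have hZ c a0 : h (c *: a0) = c *: h a0.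
      by rewrite /h aug_inZ (bilin_scalel ext_bl) (bilin_scalel pbl).
    have h0 : h 0 = 0.
      by rewrite /h aug_in0 (bilin_zerol ext_bl) (bilin_zerol pbl).
    transitivity (h (opA (contr_right beta (tsum s)) a a')).
      rewrite contr_right_tsum op_sum // (big_morph h hD h0).
      apply: eq_bigr => p _.
      rewrite hZ /op box_op_pure11 // box_op_ext ?mulr0 ?mul0r //.
      by rewrite ext_op_one_in // aug_inZ (bilin_scaler pbl).
    rewrite conds_s /= op_scale // hZ contr_left_tsum linear_sum scaler_suml.
    apply: eq_bigr => p _; rewrite /= linE /op.
    rewrite [box_op _ _ _ _ _ p.2 _ _]box_op_ext ?mulr0 ?mul0r //.
    rewrite ext_op_one_in // box_op_ext ?mulr0 ?mul0r //; last by rewrite -x'E.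
    rewrite ext_op_one_in // !aug_inZ !(bilin_scaler pbl) scalerA -x'E -xE.
    by rewrite -ext_starA xE x'E ext_op_in_in.
  (* y' = y'' = 1: the mirror image of the previous case *)
  - have [a'' x''E] := one_in _ _ _ _ ox'' y''1 xy''.
    rewrite yE y'1 y''1 x'E x''E.
    pose h a0 := box_pure (ext opA star x (aug_in a0)) (aug_in b).
    have hD a0 a1 : h (a0 + a1) = h a0 + h a1.
      by rewrite /h aug_inD (bilin_addr ext_bl) (bilin_addl pbl).
    have hZ c a0 : h (c *: a0) = c *: h a0.
      by rewrite /h aug_inZ (bilin_scaler ext_bl) (bilin_scalel pbl).
    have h0 : h 0 = 0.
      by rewrite /h aug_in0 (bilin_zeror ext_bl) (bilin_zerol pbl).
    transitivity (h (opA (contr_left alpha (tsum t)) a' a'')); last first.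
      rewrite contr_left_tsum op_sum // (big_morph h hD h0).
      apply: eq_bigr => p _.
      rewrite hZ /op box_op_pure11 // box_op_ext ?mulr0 ?mul0r //.
      by rewrite ext_op_in_one // aug_inZ (bilin_scaler pbl).
    rewrite conds_t /= op_scale // hZ contr_left_tsum linear_sum scaler_suml.
    apply: eq_bigr => p _; rewrite /= linE /op.
    rewrite [box_op _ _ _ _ _ p.1 _ _]box_op_ext ?mulr0 ?mul0r //.
    rewrite ext_op_in_one // box_op_ext ?mulr0 ?mul0r //; last by rewrite -x'E.
    rewrite ext_op_in_one // !aug_inZ !(bilin_scaler pbl) scalerA -x'E -x''E.
    by rewrite ext_starA x'E x''E ext_op_in_in mulrC.
  by apply: regular; rewrite ?yE ?y''E /= ?mulr0 ?mul0r.
elim/box_ind=> [|x x' IHx IHx'|x y ox oy xy] u v.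
- by rewrite !big1 // => p _; rewrite !op_zerol.
- have := IHx u v; have := IHx' u v.
  under [in X in _ -> _ -> X]eq_bigr => p _ do rewrite !op_addl //.
  under [in X in _ -> _ -> _ = X]eq_bigr => p _ do rewrite !op_addl //.
  by rewrite !big_split /= => -> ->.
elim/box_ind: u => [|u u' IHu IHu'|x' y' ox' oy' xy'].
- by rewrite !big1 // => p _; rewrite !(op_zerol, op_zeror).
- have := IHu; have := IHu'.
  under [in X in _ -> _ -> X]eq_bigr => p _ do rewrite !(op_addr, op_addl) //.
  under [in X in _ -> _ -> _ = X]eq_bigr => p _ do
    rewrite !(op_addr, op_addl) //.
  by rewrite !big_split /= => -> ->.
elim/box_ind: v => [|v v' IHv IHv'|x'' y'' ox'' oy'' xy'']; last exact: gen.
- by rewrite !big1 // => p _; rewrite !op_zeror.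
- have := IHv; have := IHv'.
  under [in X in _ -> _ -> X]eq_bigr => p _ do rewrite !op_addr //.
  under [in X in _ -> _ -> _ = X]eq_bigr => p _ do rewrite !op_addr //.
  by rewrite !big_split /= => -> ->.
Qed.

Lemma coherent_char :
  coherent Lam star alpha beta <->
  compatible Lam star alpha beta /\
  forall q, q \in Lam -> box_conditions star alpha beta q.
Proof.
split=> [coh | [compat conds]].
  by split=> [|q]; [case: coh | apply: coherent_box_conditions].
by split=> // A B opA opB; apply: box_algebra.
Qed.
End Boxes.

(** * The conditions in coordinates *)
Section ConditionsLinear.
Variables (k : fieldType) (Omega : vectType k) (star : Omega).
Variables (alpha beta : 'Hom(Omega, k^o)).

Lemma one_unit_conditions0 : one_unit_conditions alpha beta (0 : quad Omega).
Proof. by split; rewrite /= !linear0. Qed.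

Lemma one_unit_conditions_linear c (q q' : quad Omega) :
  one_unit_conditions alpha beta q -> one_unit_conditions alpha beta q' ->
  one_unit_conditions alpha beta (c *: q + q').
Proof.
case=> /= x y z [/= x' y' z'].
by split; rewrite /= !linearP /= ?x ?x' ?y ?y' ?z ?z'.
Qed.

Lemma box_conditions0 : box_conditions star alpha beta (0 : quad Omega).
Proof. by split; rewrite /= !linear0 scale0r. Qed.

Lemma box_conditions_linear c (q q' : quad Omega) :
  box_conditions star alpha beta q -> box_conditions star alpha beta q' ->
  box_conditions star alpha beta (c *: q + q').
Proof.
case=> /= x y [/= x' y'].
by split; rewrite /= !linearP /= ?x ?x' ?y ?y' scalerDl scalerA.
Qed.
End ConditionsLinear.

Section BasisCoordinates.
Variables (k : fieldType) (Omega : vectType k) (n : nat) (X : n.-tuple Omega).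
Hypothesis X_basis : basis_of fullv X.

Local Notation o i := (X`_i.-1).
Definition in_range i := (1 <= i <= n)%N.

(** Indices are naturals numbered from 1, as in the lists of generators; the
form is 0 for an index outside 1, ..., n. *)
Definition dual_form (i : nat) : 'Hom(Omega, k^o) :=
  \sum_(m < n | m.+1 == i) linfun (coord X m : {linear Omega -> k^o}).

Lemma dual_form_coord (m : 'I_n) u : dual_form m.+1 u = coord X m u.
Proof.
rewrite sum_lfunE (bigD1 m) //= big1 ?addr0 ?lfunE // => j.
by case/andP=> /eqP[/val_inj->]; rewrite eqxx.
Qed.

Lemma dual_form_basis i j : in_range j -> dual_form i (o j) = (i == j)%:R.
Proof.
case: j => // j /= j_n; pose j' := Ordinal j_n.
have free_X := basis_free X_basis.
have cE (m : 'I_n) :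
    linfun (coord X m : {linear Omega -> k^o}) X`_j = (j' == m)%:R.
  by rewrite lfunE /=; rewrite -(coord_free j' m free_X).
rewrite sum_lfunE -[j]/(val j'); have [->|ne_ij] := eqVneq i (val j').+1.
  rewrite (bigD1 j') //= big1 => [|m]; last first.
    by case/andP=> /eqP[e]; rewrite -val_eqE /= e eqxx.
  by rewrite /= cE eqxx addr0.
rewrite big1 // => m /eqP em; rewrite /= cE.
have -> // : (j' == m) = false.
by apply: contra_neqF ne_ij => /eqP ->; rewrite em.
Qed.

Lemma dual_form_separated u :
  (forall i, in_range i -> dual_form i u = 0) -> u = 0.
Proof.
move=> u0; rewrite (coord_basis X_basis (memvf u)) big1 // => m _.
by rewrite -dual_form_coord u0 ?scale0r // /in_range /= ltn_ord.
Qed.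

Lemma dual_form_unique (f : 'Hom(Omega, k^o)) i :
  (forall j, in_range j -> f (o j) = (i == j)%:R) -> f = dual_form i.
Proof.
move=> f_o; apply/lfunP => u; rewrite (coord_basis X_basis (memvf u)).
rewrite !linear_sum; apply: eq_bigr => m _; rewrite !linearZ; congr (_ *: _).
have m_n : in_range m.+1 by rewrite /in_range /= ltn_ord.
by rewrite [LHS](f_o _ m_n) [RHS](dual_form_basis _ m_n).
Qed.

Lemma sum_basis : \sum_(u <- X) u = \sum_(m < n) o m.+1.
Proof.
rewrite (big_nth 0) size_tuple big_mkord.
by apply: eq_bigr => m _.
Qed.

Lemma dual_form_sum i : in_range i -> dual_form i (\sum_(u <- X) u) = 1.
Proof.
case: i => // i i_n; rewrite sum_basis linear_sum (bigD1 (Ordinal i_n)) //=.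
rewrite (@dual_form_basis _ i.+1) // eqxx big1 ?addr0 // => m.
rewrite -val_eqE /= => ne_mi.
rewrite (@dual_form_basis _ m.+1) ?eqSS 1?eq_sym ?(negbTE ne_mi) //.
by rewrite /in_range /= ltn_ord.
Qed.

(** The label (b, i, j) names the coordinate l_ij of the first component of
(L, R) when b is true, and r_ij of the second one when b is false. *)
Definition label : eqType := (bool * nat * nat)%type.
Definition label_in_range (l : label) := in_range l.1.2 && in_range l.2.

Definition quad_coord (l : label) (q : quad Omega) : k^o :=
  dual_form l.2 (contr_left (dual_form l.1.2) (if l.1.1 then q.1 else q.2)).

Fact quad_coord_linear l : linear (quad_coord l).
Proof. by rewrite /quad_coord => c q q'; case: l.1.1; rewrite !linearP. Qed.

HB.instance Definition _ l :=
  GRing.isLinear.Build _ _ _ _ (quad_coord l) (quad_coord_linear l).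

(** A tensor t is the sum of o_m ⊗ t_m, where t_m is the contraction of t by
the m-th dual form. *)
Lemma tensor_separated (t : (Omega ⊗ Omega)%type) :
  (forall i j, in_range i -> in_range j ->
     dual_form j (contr_left (dual_form i) t) = 0) -> t = 0.
Proof.
move=> t0; have pbl := @pure_bilinear _ Omega Omega.
have -> : t = \sum_(m < n) o m.+1 ⊗ contr_left (dual_form m.+1) t.
  have [s ->] := tensor_pure t.
  under [RHS]eq_bigr => m _ do
    rewrite (linear_sum (contr_left _)) (bilin_sumr pbl).
  rewrite exchange_big; apply: eq_bigr => -[u v] _ /=.
  rewrite [in LHS](coord_basis X_basis (memvf u)) (bilin_suml pbl).
  apply: eq_bigr => m _; rewrite contr_left_pure /= dual_form_coord.
  by rewrite (bilin_scalel pbl) (bilin_scaler pbl).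
rewrite big1 // => m _; rewrite (_ : contr_left _ t = 0) ?(bilin_zeror pbl) //.
apply: dual_form_separated => j j_n; apply: t0 => //.
by rewrite /in_range /= ltn_ord.
Qed.

Lemma quad_separated q :
  (forall l, label_in_range l -> quad_coord l q = 0) -> q = 0.
Proof.
case: q => L R q0.
have q0' b i j : in_range i -> in_range j -> quad_coord (b, i, j) (L, R) = 0.
  by move=> i_n j_n; apply: q0; rewrite /label_in_range /= i_n.
congr (_, _); apply: tensor_separated => i j i_n j_n.
  exact: (q0' true).
exact: (q0' false).
Qed.

Lemma quad_coord_contr b i j q :
  quad_coord (b, i, j) q =
  dual_form i (contr_right (dual_form j) (if b then q.1 else q.2)).
Proof. by rewrite /quad_coord /= contr_leftC. Qed.

Lemma eq_dual_form u v :
  (forall i, in_range i -> dual_form i u = dual_form i v) -> u = v.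
Proof.
move=> uv; apply/eqP; rewrite -subr_eq0; apply/eqP/dual_form_separated => i i_n.
by rewrite linearB /= uv // subrr.
Qed.

Lemma one_unit_conditions_coord a b q :
  one_unit_conditions (dual_form a) (dual_form b) q <->
  forall j, in_range j ->
    [/\ quad_coord (true, b, j) q = quad_coord (false, b, j) q,
        quad_coord (true, a, j) q = quad_coord (false, j, b) q &
        quad_coord (true, j, a) q = quad_coord (false, j, a) q].
Proof.
split=> [[cx cy cz] j j_n | conds].
  split; rewrite /quad_coord /= ?cx ?cy //; first by rewrite -contr_leftC.
  by rewrite !contr_leftC cz.
split; apply: eq_dual_form => j j_n; have [cx cy cz] := conds j j_n => //.
  by rewrite -contr_leftC.
by rewrite -!contr_leftC.
Qed.

Lemma box_conditions_coord a b q :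
  box_conditions (\sum_(u <- X) u) (dual_form a) (dual_form b) q <->
  forall j, in_range j ->
    quad_coord (true, j, b) q = quad_coord (false, b, b) q /\
    quad_coord (false, a, j) q = quad_coord (true, a, a) q.
Proof.
split=> [[c1 c2] j j_n | conds].
  split; first rewrite quad_coord_contr /= c1; last rewrite /quad_coord /= c2;
    by rewrite linearZ /= dual_form_sum //; apply: mulr1.
split; apply: eq_dual_form => j j_n; have [c1 c2] := conds j j_n;
  rewrite linearZ /= dual_form_sum //.
  rewrite -contr_leftC -[LHS]/(quad_coord (true, j, b) q) c1.
  exact/esym/mulr1.
by rewrite -[LHS]/(quad_coord (false, a, j) q) c2; apply/esym/mulr1.
Qed.

(** All generators in the lists have coordinates 0 and 1. The set of labels with
coordinate 1 is given as a union of patterns, where None stands for a whole row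
or column, as it arises from star. *)
Definition pattern : eqType := (bool * option nat * option nat)%type.
Definition covers (l : label) (p : pattern) : bool :=
  [&& p.1.1 == l.1.1,
      (if p.1.2 is Some i then i == l.1.2 else true) &
      (if p.2 is Some j then j == l.2 else true)].

(** An entry of s consists of the coordinate that a generator owns, of its
support and of the generator itself. With these data, the hypotheses become
facts on natural numbers once the entries are listed. *)
Lemma supported_span (s : seq (label * (seq pattern * quad Omega)))
    (P : quad Omega -> Prop) :
    uniq (unzip1 s) ->
    {in s, forall e, label_in_range e.1} ->
    {in s, forall e l, label_in_range l -> 
      quad_coord l e.2.2 = (has (covers l) e.2.1)%:R} ->
    {in s &, forall e e', has (covers e.1) e'.2.1 = (e.1 == e'.1)} ->
    P 0 -> (forall c u v, P u -> P v -> P (c *: u + v)) ->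
    {in s, forall e, P e.2.2} ->
    (forall q, P q -> {in s, forall e, quad_coord e.1 q = 0} ->
       forall l, label_in_range l -> quad_coord l q = 0) ->
  free [seq e.2.2 | e <- s] /\
  forall q, q \in <<[seq e.2.2 | e <- s]>>%VS <-> P q.
Proof.
move=> s_uniq s_range s_supp s_private P0 Plin sP Psep.
pose f l : {linear quad Omega -> k^o} := quad_coord l.
pose s' := [seq (e.1, e.2.2) | e <- s].
have s'2 : [seq e.2.2 | e <- s] = unzip2 s' by rewrite /unzip2 -map_comp.
have s'1 : uniq (unzip1 s') by rewrite /unzip1 -map_comp.
have s'dual : {in s' &, forall p q, f p.1 q.2 = (p.1 == q.1)%:R}.
  move=> _ _ /mapP[e es ->] /mapP[e' e's ->] /=.
  by rewrite /f s_supp ?s_range // s_private.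
rewrite s'2; split; first exact: dual_family_free s'1 s'dual.
apply: (dual_family_span s'1 s'dual) => //.
  by move=> _ /mapP[e es ->]; apply: sP.
move=> q Pq q0; apply: quad_separated => l l_n; apply: Psep => // e es.
by apply: (q0 (e.1, e.2.2)); apply/mapP; exists e.
Qed.

End BasisCoordinates.

(** * The four lists of generators *)
Ltac case_entry :=
  let i := fresh "i" in let j := fresh "j" in
  let i_n := fresh "i_n" in let j_n := fresh "j_n" in
  rewrite ?mem_cat ?inE; repeat case/orP;
  first [ case/mapP; intros i; rewrite mem_index_iota; intros i_n ->
        | case/allpairsP; intros [i j]; rewrite /= !mem_index_iota;
          intros [i_n j_n ->]
        | move/eqP; intros -> ].

Ltac coordinates :=
  rewrite /quad_coord /covers /=;
  rewrite ?linear0 ?contr_left_pure ?linearZ ?linearD /=;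
  rewrite ?contr_left_pure ?linearZ ?linearD /=.

Section Generators.
Variables (k : fieldType) (Omega : vectType k) (n : nat) (X : n.-tuple Omega).
Hypothesis X_basis : basis_of fullv X.
Variable o : nat -> Omega.
Hypothesis dual_form_o : forall i j, in_range n j ->
  dual_form X i (o j) = (i == j)%:R.
Let star := \sum_(u <- X) u.
Let dual_form_star i : in_range n i -> dual_form X i star = true%:R.
Proof. exact: dual_form_sum. Qed.
Local Notation entry := (label * (seq pattern * quad Omega))%type.
Local Notation coord l q := (quad_coord X l q).

Definition unit_entry b i j : entry :=
  ((b, i, j), ([:: (b, Some i, Some j)],
     if b then (o i ⊗ o j, 0) else (0, o i ⊗ o j))).

Definition all_pairs_entries (i0 : nat) : seq entry :=
  [seq unit_entry true i j | i <- index_iota i0 n.+1,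
      j <- index_iota i0 n.+1] ++
  [seq unit_entry false i j | i <- index_iota i0 n.+1, j <- index_iota i0 n.+1].

Lemma uniq_labels_cat (s s' : seq entry) :
  uniq (unzip1 s) -> uniq (unzip1 s') ->
  (forall e e', e \in s -> e' \in s' -> e.1 != e'.1) -> uniq (unzip1 (s ++ s')).
Proof.
move=> us us' ne; rewrite /unzip1 map_cat cat_uniq us us' /= andbT.
apply/hasPn => _ /mapP[e' e's' ->]; apply/mapP => -[e es ee'].
by have := ne e e' es e's'; rewrite ee' eqxx.
Qed.

Lemma uniq_labels_map (f : nat -> entry) i0 :
  injective (fun i => (f i).1) ->
  uniq (unzip1 [seq f i | i <- index_iota i0 n.+1]).
Proof.
by move=> f_inj; rewrite /unzip1 -map_comp map_inj_uniq ?iota_uniq.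
Qed.

Lemma uniq_all_pairs_entries i0 : uniq (unzip1 (all_pairs_entries i0)).
Proof.
apply: uniq_labels_cat => [||e e'].
- rewrite /unzip1 map_allpairs.
  by apply: allpairs_uniq => [||[i j] [i' j'] _ _ [-> ->]]; rewrite ?iota_uniq.
- rewrite /unzip1 map_allpairs.
  by apply: allpairs_uniq => [||[i j] [i' j'] _ _ [-> ->]]; rewrite ?iota_uniq.
by move=> /allpairsP[p [_ _ ->]] /allpairsP[p' [_ _ ->]].
Qed.

Lemma scale_natE (a b : nat) : (a%:R : k) *: (b%:R : k^o) = (a * b)%:R.
Proof. by rewrite natrM. Qed.

Section Vanishing.
Variable q : quad Omega.
Local Notation vanish s := (all (fun e : entry => coord e.1 q == 0) s).

Lemma vanish_map (f : nat -> entry) i0 :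
  vanish [seq f i | i <- index_iota i0 n.+1] ->
  forall i, (i0 <= i <= n)%N -> coord (f i).1 q = 0.
Proof.
rewrite all_map => /allP q0 i i_n; apply/eqP/q0.
by rewrite mem_index_iota.
Qed.

Lemma vanish_all_pairs i0 : vanish (all_pairs_entries i0) ->
  forall b i j, (i0 <= i <= n)%N -> (i0 <= j <= n)%N -> coord (b, i, j) q = 0.
Proof.
rewrite all_cat => /andP[/all_allpairsP q0 /all_allpairsP q1] b i j i_n j_n.
by case: b; apply/eqP; [apply: q0 | apply: q1]; rewrite mem_index_iota.
Qed.

(** In L only l_22 is missing from the hypotheses, and l_22 = r_22 = l_12; then
every other r_ij is equal to a coordinate of L by one of the conditions. *)
Lemma neq_vanish :
    one_unit_conditions (dual_form X 1) (dual_form X 2) q ->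
    coord (true, 1, 1) q = 0 -> coord (true, 1, 2) q = 0 ->
    (forall i, (2 <= i <= n)%N -> coord (true, i, 1) q = 0) ->
    (forall j, (3 <= j <= n)%N -> coord (true, 2, j) q = 0) ->
    (forall i, (3 <= i <= n)%N -> coord (true, 1, i) q = 0) ->
    (forall i, (3 <= i <= n)%N -> coord (true, i, 2) q = 0) ->
    (forall i, (3 <= i <= n)%N -> coord (false, 1, i) q = 0) ->
    (forall b i j, (3 <= i <= n)%N -> (3 <= j <= n)%N ->
       coord (b, i, j) q = 0) ->
  forall l, label_in_range n l -> coord l q = 0.
Proof.
move=> /(one_unit_conditions_coord X_basis) cond.
move=> q11 q12 qi1 q2j q1i qi2 r1i qij.
have q0 x y : in_range n x -> in_range n y -> coord (true, x, y) q = 0.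
  case: x y => [|[|[|x]]] [|[|[|y]]] // x_n y_n;
    try by [apply: qi1 | apply: q2j | apply: q1i | apply: qi2 | apply: qij].
  by have [-> <- _] := cond 2 x_n.
move=> [[[] x] y] /andP[/= x_n y_n]; first exact: q0.
case: x y x_n y_n => [|[|[|x]]] [|[|[|y]]] // x_n y_n;
  try by [apply: r1i | apply: qij];
  try by [have [_ _ <-] := cond _ x_n; apply: q0
    | have [_ <- _] := cond _ x_n; apply: q0 => //; move: x_n;
      rewrite /in_range; lia
    | have [<- _ _] := cond _ y_n; apply: q0].
Qed.

Lemma eq_vanish :
    one_unit_conditions (dual_form X 1) (dual_form X 1) q ->
    (forall i, in_range n i -> coord (true, 1, i) q = 0) ->
    (forall b i j, (2 <= i <= n)%N -> (2 <= j <= n)%N ->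
       coord (b, i, j) q = 0) ->
  forall l, label_in_range n l -> coord l q = 0.
Proof.
move=> /(one_unit_conditions_coord X_basis) cond q1i qij.
move=> [[b x] y] /andP[/= x_n y_n].
case: x x_n => [|[|x]] // x_n.
  by case: b; last (have [<- _ _] := cond _ y_n); apply: q1i.
case: y y_n => [|[|y]] // y_n; last exact: qij.
by have [_ e1 e2] := cond _ x_n; case: b; rewrite ?e2 -e1; apply: q1i.
Qed.
End Vanishing.

(** Evaluates a coordinate of a generator as a sum of products of Kronecker
deltas, and compares it with the support by arithmetic of booleans. *)
Ltac supports :=
  coordinates; rewrite ?dual_form_o ?dual_form_star //;
  try (by rewrite /in_range; lia);
  rewrite -?natrD ?scale_natE -?natrD ?mulnDl ?mulnb;
  by [congr (_%:R); lia | rewrite -[LHS]/(0%:R); congr (_%:R); lia].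

Ltac distinct_labels :=
  repeat first [by [] | by apply: uniq_labels_map => ? ? [] |
    exact: uniq_all_pairs_entries | apply: uniq_labels_cat];
  by intros e e'; case_entry; case_entry; rewrite /= ?xpair_eqE //; lia.

(** The generators own all l_ij except l_22, and the r_1i and r_ij with
i, j >= 3. *)
Definition comp_neq_entries : seq entry :=
  [:: ((true, 1, 2), ([:: (true, Some 1, Some 2); (true, Some 2, Some 2);
                         (false, Some 2, Some 2)],
        ((o 1 + o 2) ⊗ o 2, o 2 ⊗ o 2)));
      ((true, 1, 1), ([:: (true, Some 1, Some 1); (false, Some 1, Some 1);
                         (false, Some 1, Some 2)],
        (o 1 ⊗ o 1, o 1 ⊗ (o 1 + o 2))))] ++
  [seq ((true, i, 1), ([:: (true, Some i, Some 1); (false, Some i, Some 1)],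
        (o i ⊗ o 1, o i ⊗ o 1))) | i <- index_iota 2 n.+1] ++
  [seq ((true, 2, j), ([:: (true, Some 2, Some j); (false, Some 2, Some j)],
        (o 2 ⊗ o j, o 2 ⊗ o j))) | j <- index_iota 3 n.+1] ++
  [seq ((true, 1, i), ([:: (true, Some 1, Some i); (false, Some i, Some 2)],
        (o 1 ⊗ o i, o i ⊗ o 2))) | i <- index_iota 3 n.+1] ++
  [seq unit_entry true i 2 | i <- index_iota 3 n.+1] ++
  [seq unit_entry false 1 i | i <- index_iota 3 n.+1] ++
  all_pairs_entries 3.

Lemma comp_neq_entries_vectors :
  [seq e.2.2 | e <- comp_neq_entries] = comp_neq_basis n o.
Proof.
by rewrite !map_cat -!map_comp !map_allpairs.
Qed.

Hypothesis n_ge1 : (1 <= n)%N.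

Lemma comp_neq_span : (2 <= n)%N ->
  free (comp_neq_basis n o) /\
  forall q, q \in <<comp_neq_basis n o>>%VS <->
    one_unit_conditions (dual_form X 1) (dual_form X 2) q.
Proof.
move=> n_ge2.
have supp : {in comp_neq_entries, forall e l, label_in_range n l ->
    coord l e.2.2 = (has (covers l) e.2.1)%:R}.
  by move=> e + [[b x] y] /andP[/= x_n y_n]; case_entry; case: b; supports.
rewrite -comp_neq_entries_vectors; apply: (supported_span X_basis) => //.
- distinct_labels.
- by move=> e; case_entry; rewrite /label_in_range /in_range /=; lia.
- by move=> e e'; case_entry; case_entry; rewrite /covers /= !xpair_eqE; lia.
- exact: one_unit_conditions0.
- exact: one_unit_conditions_linear.
- move=> e es; apply/one_unit_conditions_coord => // j j_n.
  have n1 : in_range n 1 by rewrite /in_range; lia.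
  have n2 : in_range n 2 by rewrite /in_range; lia.
  rewrite !supp /label_in_range //= ?n1 ?n2 ?j_n //.
  by move: es; case_entry; rewrite /covers /=; split; congr (_%:R); lia.
move=> q cond q0.
have {q0} : all (fun e : entry => coord e.1 q == 0) comp_neq_entries.
  by apply/allP => e es; rewrite q0.
rewrite 6!all_cat => /andP[/and3P[/eqP q12 /eqP q11 _]].
case/andP=> /vanish_map qi1 /andP[/vanish_map q2j] /andP[/vanish_map q1i].
case/andP=> /vanish_map qi2 /andP[/vanish_map r1i] /vanish_all_pairs.
exact: neq_vanish.
Qed.

(** The box conditions link l_i2 to r_22 and r_1i to l_11, so compared with the
compatible case the generators owning l_i2 and r_1i disappear, and the first
two spread over a column and a row. *)
Definition coh_neq_entries : seq entry :=
  [:: ((true, 1, 2), ([:: (true, None, Some 2); (false, Some 2, Some 2)],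
        (star ⊗ o 2, o 2 ⊗ o 2)));
      ((true, 1, 1), ([:: (true, Some 1, Some 1); (false, Some 1, None)],
        (o 1 ⊗ o 1, o 1 ⊗ star)))] ++
  [seq ((true, i, 1), ([:: (true, Some i, Some 1); (false, Some i, Some 1)],
        (o i ⊗ o 1, o i ⊗ o 1))) | i <- index_iota 2 n.+1] ++
  [seq ((true, 2, j), ([:: (true, Some 2, Some j); (false, Some 2, Some j)],
        (o 2 ⊗ o j, o 2 ⊗ o j))) | j <- index_iota 3 n.+1] ++
  [seq ((true, 1, i), ([:: (true, Some 1, Some i); (false, Some i, Some 2)],
        (o 1 ⊗ o i, o i ⊗ o 2))) | i <- index_iota 3 n.+1] ++
  all_pairs_entries 3.

Lemma coh_neq_entries_vectors :
  [seq e.2.2 | e <- coh_neq_entries] = coh_neq_basis n star o.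
Proof. by rewrite !map_cat -!map_comp !map_allpairs. Qed.

Lemma coh_neq_span : (2 <= n)%N ->
  free (coh_neq_basis n star o) /\
  forall q, q \in <<coh_neq_basis n star o>>%VS <->
    one_unit_conditions (dual_form X 1) (dual_form X 2) q /\
    box_conditions star (dual_form X 1) (dual_form X 2) q.
Proof.
move=> n_ge2.
have supp : {in coh_neq_entries, forall e l, label_in_range n l ->
    coord l e.2.2 = (has (covers l) e.2.1)%:R}.
  by move=> e + [[b x] y] /andP[/= x_n y_n]; case_entry; case: b; supports.
have n1 : in_range n 1 by rewrite /in_range; lia.
have n2 : in_range n 2 by rewrite /in_range; lia.
rewrite -coh_neq_entries_vectors; apply: (supported_span X_basis) => //.
- distinct_labels.
- by move=> e; case_entry; rewrite /label_in_range /in_range /=; lia.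
- by move=> e e'; case_entry; case_entry; rewrite /covers /= !xpair_eqE; lia.
- by split; [apply: one_unit_conditions0 | apply: box_conditions0].
- move=> c u v [u1 u2] [v1 v2].
  by split; [apply: one_unit_conditions_linear | apply: box_conditions_linear].
- move=> e es; split; [apply/one_unit_conditions_coord => // j j_n |
                       apply/box_conditions_coord => // j j_n];
  rewrite !supp /label_in_range //= ?n1 ?n2 ?j_n //.
    by move: es; case_entry; rewrite /covers /=; split; congr (_%:R); lia.
  by move: es; case_entry; rewrite /covers /=; split; congr (_%:R); lia.
move=> q [cond /(box_conditions_coord X_basis) box] q0.
have {q0} : all (fun e : entry => coord e.1 q == 0) coh_neq_entries.
  by apply/allP => e es; rewrite q0.
rewrite 4!all_cat => /andP[/and3P[/eqP q12 /eqP q11 _]].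
case/andP=> /vanish_map qi1 /andP[/vanish_map q2j] /andP[/vanish_map q1i].
move=> /vanish_all_pairs qij; apply: neq_vanish => // i i_n;
  have /box[box1 box2] : in_range n i by rewrite /in_range; lia.
  by rewrite box1; have /box[<- _] := n1.
by rewrite box2.
Qed.

(** The conditions make row 1 and column 1 of L and of R all equal, as
functions of the index; the l_1i are taken as owned coordinates. *)
Definition comp_eq_entries : seq entry :=
  [:: ((true, 1, 1), ([:: (true, Some 1, Some 1); (false, Some 1, Some 1)],
        (o 1 ⊗ o 1, o 1 ⊗ o 1)))] ++
  [seq ((true, 1, i), ([:: (true, Some 1, Some i); (false, Some 1, Some i);
                          (true, Some i, Some 1); (false, Some i, Some 1)],
        (o 1 ⊗ o i, o 1 ⊗ o i) + (o i ⊗ o 1, o i ⊗ o 1)))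
     | i <- index_iota 2 n.+1] ++
  all_pairs_entries 2.

Lemma comp_eq_entries_vectors :
  [seq e.2.2 | e <- comp_eq_entries] = comp_eq_basis n o.
Proof. by rewrite !map_cat -!map_comp !map_allpairs. Qed.

Lemma comp_eq_span :
  free (comp_eq_basis n o) /\
  forall q, q \in <<comp_eq_basis n o>>%VS <->
    one_unit_conditions (dual_form X 1) (dual_form X 1) q.
Proof.
have supp : {in comp_eq_entries, forall e l, label_in_range n l ->
    coord l e.2.2 = (has (covers l) e.2.1)%:R}.
  by move=> e + [[b x] y] /andP[/= x_n y_n]; case_entry; case: b; supports.
rewrite -comp_eq_entries_vectors; apply: (supported_span X_basis) => //.
- distinct_labels.
- by move=> e; case_entry; rewrite /label_in_range /in_range /=; lia.
- by move=> e e'; case_entry; case_entry; rewrite /covers /= !xpair_eqE; lia.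
- exact: one_unit_conditions0.
- exact: one_unit_conditions_linear.
- move=> e es; apply/one_unit_conditions_coord => // j j_n.
  have n1 : in_range n 1 by rewrite /in_range; lia.
  rewrite !supp /label_in_range //= ?n1 ?j_n //.
  by move: es; case_entry; rewrite /covers /=; split; congr (_%:R); lia.
move=> q cond q0.
have {q0} : all (fun e : entry => coord e.1 q == 0) comp_eq_entries.
  by apply/allP => e es; rewrite q0.
rewrite 2!all_cat => /andP[/andP[/eqP q11 _]].
case/andP=> /vanish_map q1i /vanish_all_pairs; apply: eq_vanish => //.
by case=> [|[|i]] // i_n; apply: q1i.
Qed.

(** The box conditions make row 1 and column 1 constant, so that l_11 alone is
owned there. *)
Definition coh_eq_entries : seq entry :=
  [:: ((true, 1, 1), ([:: (true, Some 1, None); (true, None, Some 1);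
                      (false, Some 1, None); (false, None, Some 1)],
     (o 1 ⊗ star, o 1 ⊗ star) + (star ⊗ o 1, star ⊗ o 1)
       - (o 1 ⊗ o 1, o 1 ⊗ o 1)))] ++
  all_pairs_entries 2.

Lemma coh_eq_entries_vectors :
  [seq e.2.2 | e <- coh_eq_entries] = coh_eq_basis n star o.
Proof. by rewrite /= map_cat !map_allpairs. Qed.

Lemma coh_eq_span :
  free (coh_eq_basis n star o) /\
  forall q, q \in <<coh_eq_basis n star o>>%VS <->
    one_unit_conditions (dual_form X 1) (dual_form X 1) q /\
    box_conditions star (dual_form X 1) (dual_form X 1) q.
Proof.
have n1 : in_range n 1 by rewrite /in_range; lia.
(* row 1 and column 1 overlap in one coordinate, which is counted once *)
have orE (a b : bool) : (a : nat)%:R + b%:R - (a && b)%:R = (a || b)%:R :> k.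
  by case: a; case: b; rewrite /= ?subr0 ?addr0 ?add0r ?addrK.
have supp : {in coh_eq_entries, forall e l, label_in_range n l ->
    coord l e.2.2 = (has (covers l) e.2.1)%:R}.
  move=> e + [[b x] y] /andP[/= x_n y_n]; rewrite mem_cat inE => /orP[/eqP->|].
    case: b; rewrite /quad_coord /= !linearD !linearN /= !contr_left_pure.
      rewrite !linearZ /= !dual_form_o // !dual_form_star // scalerN
        !scale_natE.
      by rewrite !mulnb andbT andTb orE; congr (_%:R); rewrite /covers /=; lia.
    rewrite !linearZ /= !dual_form_o // !dual_form_star // scalerN
        !scale_natE.
    by rewrite !mulnb andbT andTb orE; congr (_%:R); rewrite /covers /=; lia.
  by case_entry; case: b; supports.
rewrite -coh_eq_entries_vectors; apply: (supported_span X_basis) => //.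
- distinct_labels.
- by move=> e; case_entry; rewrite /label_in_range /in_range /=; lia.
- by move=> e e'; case_entry; case_entry; rewrite /covers /= !xpair_eqE; lia.
- by split; [apply: one_unit_conditions0 | apply: box_conditions0].
- move=> c u v [u1 u2] [v1 v2].
  by split; [apply: one_unit_conditions_linear | apply: box_conditions_linear].
- move=> e es; split; [apply/one_unit_conditions_coord => // j j_n |
                       apply/box_conditions_coord => // j j_n];
  rewrite !supp /label_in_range //= ?n1 ?j_n //.
    by move: es; case_entry; rewrite /covers /=; split; congr (_%:R); lia.
  by move: es; case_entry; rewrite /covers /=; split; congr (_%:R); lia.
move=> q [cond /(box_conditions_coord X_basis) box] q0.
have {q0} : all (fun e : entry => coord e.1 q == 0) coh_eq_entries.
  by apply/allP => e es; rewrite q0.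
rewrite all_cat => /andP[/andP[/eqP q11 _]] /vanish_all_pairs.
apply: eq_vanish => // i i_n.
have [-> _ _] := (one_unit_conditions_coord X_basis _ _ _).1 cond i i_n.
by have [_ ->] := box i i_n.
Qed.

End Generators.

(** * Bases adapted to a unit action *)
Section AdaptedBasis.
Variables (k : fieldType) (Omega : vectType k) (n : nat).
Hypothesis dim_Omega : \dim {:Omega} = n.
Variables (star : Omega) (alpha beta : 'Hom(Omega, k^o)).
Hypothesis alpha1 : alpha star = 1.

Lemma basis_tuple (s : seq Omega) : free s -> (forall u, u \in <<s>>%VS) ->
  exists2 X : n.-tuple Omega, s = X & basis_of fullv X.
Proof.
move=> s_free s_span.
have s_basis : basis_of fullv (in_tuple s).
  by rewrite /basis_of s_free andbT eqEsubv subvf; apply/subvP => u _.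
have /eqP s_n : size s = n by rewrite -dim_Omega (size_basis s_basis).
by exists (Tuple s_n).
Qed.

Lemma notin_span (f : 'Hom(Omega, k^o)) v (s : seq Omega) :
  f v = 1 -> {in s, forall w, f w = 0} -> v \notin <<s>>%VS.
Proof.
move=> fv fs; apply/negP => v_s; have /subvP/(_ _ v_s) : (<<s>> <= lker f)%VS.
  by apply/span_subvP => w /fs; rewrite memv_ker => ->.
by rewrite memv_ker fv oner_eq0.
Qed.

(** A vector with alpha <> beta, corrected by a multiple of star and rescaled,
gives o_1; the basis of the common kernel is arbitrary, and o_2 is what is
missing in the sum to star. *)
Lemma adapted_basis_neq : beta star = 1 -> alpha <> beta ->
  exists X : n.-tuple Omega, [/\ (2 <= n)%N, basis_of fullv X,
    star = \sum_(o <- X) o, alpha = dual_form X 1 & beta = dual_form X 2].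
Proof.
move=> beta1 ne_ab.
have /lfunPn[u ne_u] : alpha != beta by apply/eqP.
have linE (f : 'Hom(Omega, k^o)) c v : f (c *: v) = (c * f v : k).
  exact: linearZ.
pose U := (lker alpha :&: lker beta)%VS; pose K : seq Omega := vbasis U.
have K0 v : v \in K -> alpha v = 0 /\ beta v = 0.
  move=> /vbasis_mem; rewrite memv_cap !memv_ker => /andP[/eqP ? /eqP ?].
  by split.
have [o1 [a1 b1]] : exists o1, alpha o1 = 1 /\ beta o1 = 0.
  have d0 : (alpha u - beta u : k) != 0 by rewrite subr_eq0.
  exists ((alpha u - beta u : k)^-1 *: (u - (beta u : k) *: star)).
  rewrite !linE !linearB /= !linE alpha1 beta1 !mulr1 subrr mulr0.
  by split=> //; apply: mulVf.
have [o2 starE] : exists o2, star = o1 + (o2 + \sum_(v <- K) v).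
  by exists (star - o1 - \sum_(v <- K) v); rewrite subrK addrC subrK.
have aS : alpha (\sum_(v <- K) v) = 0.
  by rewrite linear_sum big_seq big1 // => v /K0[].
have bS : beta (\sum_(v <- K) v) = 0.
  by rewrite linear_sum big_seq big1 // => v /K0[].
have a2 : alpha o2 = 0.
  have := alpha1; rewrite starE !linearD /= a1 aS addr0.
  by rewrite -[RHS]addr0 => /addrI.
have b2 : beta o2 = 1 by rewrite -beta1 starE !linearD /= b1 bS addr0 add0r.
have [|v|X XE X_basis] := @basis_tuple (o1 :: o2 :: K).
- rewrite !free_cons (basis_free (vbasisP U)) andbT; apply/andP; split.
    apply: (notin_span a1) => // w; rewrite inE => /orP[/eqP-> //|].
    by case/K0.
  by apply: (notin_span b2) => // w /K0[].
- have -> : v = (alpha v : k) *: o1 + (beta v : k) *: o2 +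
      (v - (alpha v : k) *: o1 - (beta v : k) *: o2).
    by rewrite -[_ - _ - _]addrA -opprD [RHS]addrC subrK.
  have KU : <<K>>%VS = U by apply/eqP; case/andP: (vbasisP U).
  apply: rpredD; first by apply: rpredD; apply: rpredZ; apply: memv_span;
    rewrite !inE eqxx ?orbT.
  rewrite -(cat1s o1) -(cat1s o2) !span_cat KU.
  apply: (subvP (addvSr _ _)); apply: (subvP (addvSr _ _)).
  rewrite memv_cap !memv_ker !linearB /= !linE a1 b1 a2 b2 !mulr0 !mulr1.
  by rewrite !subr0 !subrr eqxx.
have n2 : (2 <= n)%N by rewrite -(size_tuple X) -XE.
have nthK j : in_range n j.+3 -> K`_j \in K.
  by move=> /andP[_]; rewrite -(size_tuple X) -XE => j_K; apply: mem_nth.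
exists X; split=> //.
- by rewrite -XE !big_cons.
- apply: (dual_form_unique X_basis) => -[|[|[|j]]] // j_n; rewrite -XE //=.
  by have [->] := K0 _ (nthK _ j_n).
apply: (dual_form_unique X_basis) => -[|[|[|j]]] // j_n; rewrite -XE //=.
by have [_ ->] := K0 _ (nthK _ j_n).
Qed.

Lemma adapted_basis_eq :
  exists X : n.-tuple Omega, [/\ (1 <= n)%N, basis_of fullv X,
    star = \sum_(o <- X) o & alpha = dual_form X 1].
Proof.
have linE (f : 'Hom(Omega, k^o)) c v : f (c *: v) = (c * f v : k).
  exact: linearZ.
pose K : seq Omega := vbasis (lker alpha).
have K0 v : v \in K -> alpha v = 0.
  by move=> /vbasis_mem; rewrite memv_ker => /eqP.
have [o1 starE] : exists o1, star = o1 + \sum_(v <- K) v.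
  by exists (star - \sum_(v <- K) v); rewrite subrK.
have a1 : alpha o1 = 1.
  rewrite -alpha1 starE linearD linear_sum /=.
  by rewrite [X in _ + X]big_seq big1 ?addr0 // => v /K0.
have [|v|X XE X_basis] := @basis_tuple (o1 :: K).
- rewrite free_cons (basis_free (vbasisP _)) andbT.
  by apply: (notin_span a1) => w /K0.
- have -> : v = (alpha v : k) *: o1 + (v - (alpha v : k) *: o1).
    by rewrite addrC subrK.
  have KU : <<K>>%VS = lker alpha.
    by apply/eqP; case/andP: (vbasisP (lker alpha)).
  apply: rpredD; first by apply/rpredZ/memv_span; rewrite inE eqxx.
  rewrite -(cat1s o1) span_cat KU; apply: (subvP (addvSr _ _)).
  by rewrite memv_ker linearB /= linE a1 mulr1 subrr.
exists X; split=> //; first by rewrite -(size_tuple X) -XE.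
  by rewrite -XE big_cons.
apply: (dual_form_unique X_basis) => -[|[|j]] // /andP[_ j_n].
  by rewrite -XE.
rewrite -XE; apply: K0; apply: mem_nth.
by move: j_n; rewrite -(size_tuple X) -XE.
Qed.
End AdaptedBasis.

Section Criteria.
Variables (k : fieldType) (Omega : vectType k) (n : nat).
Hypothesis dim_Omega : \dim {:Omega} = n.
Variables (Lam : {vspace quad Omega}) (star : Omega).
Variable Phi : 'Hom(Omega, k^o) -> 'Hom(Omega, k^o) -> Prop.
Variable Q : 'Hom(Omega, k^o) -> 'Hom(Omega, k^o) -> quad Omega -> Prop.
Variable L : (nat -> Omega) -> seq (quad Omega).
Hypothesis PhiE : forall alpha beta, Phi alpha beta <->
  unit_action star alpha beta /\ forall q, q \in Lam -> Q alpha beta q.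

Lemma sub_span_iff (X : seq (quad Omega)) (P : quad Omega -> Prop) :
  free X /\ (forall q, q \in <<X>>%VS <-> P q) ->
  (exists2 W, basis_of W X & (Lam <= W)%VS) <-> (forall q, q \in Lam -> P q).
Proof.
case=> X_free XP; split=> [[W /andP[/eqP <- _] /subvP LamW] q Lam_q | LamP].
  exact/XP/LamW.
exists <<X>>%VS; first by rewrite /basis_of eqxx.
by apply/subvP => q Lam_q; apply/XP/LamP.
Qed.

(** Both directions go through the dual forms: a unit action gives an adapted
basis with alpha and beta among its dual forms, and the dual forms of any basis
with sum star are 1 at star. *)
Lemma in_adapted_span_neq :
    (forall X : n.-tuple Omega, basis_of fullv X -> (2 <= n)%N ->
       star = \sum_(o <- X) o ->
       free (L (fun i => X`_i.-1)) /\
       forall q, q \in <<L (fun i => X`_i.-1)>>%VS <->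
         Q (dual_form X 1) (dual_form X 2) q) ->
  (exists alpha beta, Phi alpha beta /\ alpha <> beta) <->
  in_adapted_span n star 2 Lam L.
Proof.
move=> LQ; split=> [[alpha [beta [/PhiE[[alpha1 beta1] LamQ] ne_ab]]] |].
  have [X [n2 X_basis starE aE bE]] :=
    adapted_basis_neq dim_Omega alpha1 beta1 ne_ab.
  exists X; split=> //; apply/(sub_span_iff (LQ X X_basis n2 starE)).
  by rewrite -aE -bE.
case=> X [n2 X_basis starE /(sub_span_iff (LQ X X_basis n2 starE)) LamQ].
have n1 : in_range n 1 by rewrite /in_range (leq_trans _ n2).
have n2' : in_range n 2 by [].
exists (dual_form X 1), (dual_form X 2); split.
  by apply/PhiE; split=> //; rewrite /unit_action starE !dual_form_sum.
move/(congr1 (fun f : 'Hom(Omega, k^o) => f X`_1)) => /eqP.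
rewrite (dual_form_basis X_basis 1 n2') (dual_form_basis X_basis 2 n2').
by rewrite eq_sym oner_eq0.
Qed.

Lemma in_adapted_span_eq :
    (forall X : n.-tuple Omega, basis_of fullv X -> (1 <= n)%N ->
       star = \sum_(o <- X) o ->
       free (L (fun i => X`_i.-1)) /\
       forall q, q \in <<L (fun i => X`_i.-1)>>%VS <->
         Q (dual_form X 1) (dual_form X 1) q) ->
  (exists alpha beta, Phi alpha beta /\ alpha = beta) <->
  in_adapted_span n star 1 Lam L.
Proof.
move=> LQ; split=> [[alpha [beta [/PhiE[[alpha1 _]]]]] |].
  move=> + ab; rewrite -{}ab => LamQ.
  have [X [n1 X_basis starE aE]] := adapted_basis_eq dim_Omega alpha1.
  exists X; split=> //; apply/(sub_span_iff (LQ X X_basis n1 starE)).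
  by rewrite -aE.
case=> X [n1 X_basis starE /(sub_span_iff (LQ X X_basis n1 starE)) LamQ].
exists (dual_form X 1), (dual_form X 1); split=> //.
by apply/PhiE; split=> //; rewrite /unit_action starE !dual_form_sum.
Qed.
End Criteria.

Theorem theorem3p1 (k : fieldType) (k_char0 : [pchar k] =i pred0) (n : nat)
    (Omega : vectType k) (dim_Omega : \dim {:Omega} = n)
    (Lam : {vspace quad Omega}) (star : Omega)
    (star_assoc : (star ⊗ star, star ⊗ star) \in Lam) :
  [/\ (exists alpha beta : 'Hom(Omega, k^o),
         coherent Lam star alpha beta /\ alpha <> beta) <->
      in_adapted_span n star 2 Lam (coh_neq_basis n star),
      (exists alpha beta : 'Hom(Omega, k^o),
         coherent Lam star alpha beta /\ alpha = beta) <->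
      in_adapted_span n star 1 Lam (coh_eq_basis n star),
      (exists alpha beta : 'Hom(Omega, k^o),
         compatible Lam star alpha beta /\ alpha <> beta) <->
      in_adapted_span n star 2 Lam (@comp_neq_basis k Omega n) &
      (exists alpha beta : 'Hom(Omega, k^o),
         compatible Lam star alpha beta /\ alpha = beta) <->
      in_adapted_span n star 1 Lam (@comp_eq_basis k Omega n)].
Proof.
have cohE alpha beta : coherent Lam star alpha beta <->
    unit_action star alpha beta /\ forall q, q \in Lam ->
    one_unit_conditions alpha beta q /\ box_conditions star alpha beta q.
  rewrite (coherent_char _ _ star_assoc) compatible_char.
  split=> [[[u c] b]|[u cb]].
    by split=> // q Lq; split; [apply: c | apply: b].
  by split=> [|q /cb[]//]; split=> // q /cb[].
have compE := compatible_char star _ _ Lam.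
have dualE (X : n.-tuple Omega) (Xb : basis_of fullv X) i j :
    in_range n j -> dual_form X i X`_j.-1 = (i == j)%:R.
  exact: dual_form_basis.
split.
- apply: (in_adapted_span_neq dim_Omega cohE) => X Xb n2 ->.
  by apply: coh_neq_span => //; [apply: dualE | apply: leq_trans n2].
- apply: (in_adapted_span_eq dim_Omega cohE) => X Xb n1 ->.
  by apply: coh_eq_span => //; apply: dualE.
- apply: (in_adapted_span_neq dim_Omega compE) => X Xb n2 _.
  by apply: comp_neq_span => //; [apply: dualE | apply: leq_trans n2].
- apply: (in_adapted_span_eq dim_Omega compE) => X Xb n1 _.
  by apply: comp_eq_span => //; apply: dualE.
Qed.
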